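(* Let $n\ge1$ and $k\ge1$. For $\lambda\vdash n$, the probability that the permutation obtained after $k$ successive top to random shuffles of an $n$-card deck has RSK shape $\lambda$ equals \[ \frac{f_\lambda^2}{n!}\sum_{a=1}^nP(a,k,n)\,(n-a)!\,\frac{f_{\lambda/(n-a)}}{f_\lambda},\] where $P(a,k,n)$ is the probability that when $k$ balls are dropped independently and uniformly at random into $n$ boxes, exactly $a$ boxes are occupied.
   Context: A top to random shuffle removes the top card of the deck and inserts it into a uniformly random one of the $n$ possible positions. The RSK shape of a permutation is the common shape of its insertion and recording tableaux. $f_\lambda$ is the number of standard Young tableaux of shape $\lambda$, and $f_{\lambda/(m)}$ is the number of standard Young tableaux of skew shape $\lambda/(m)$ (zero if $\lambda_1<m$; $f_{\lambda/(0)}=f_\lambda$). *)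

(* Defs.v *)
From mathcomp Require Import all_boot all_order all_algebra.
Set Implicit Arguments. Unset Strict Implicit. Unset Printing Implicit Defensive.
Import GRing.Theory Num.Theory.

Definition is_partition (l : seq nat) : bool :=
  sorted geq l && all (fun x => 0 < x) l.
Definition partition_of (n : nat) (l : seq nat) : bool :=
  is_partition l && (sumn l == n).

(* Cells of the skew shape lambda/(m): (i,j) with j < lambda_i, except the
   first m cells of row 0.  All cells of lambda fit in 'I_N x 'I_N, N = |lambda|. *)
Definition in_skew (l : seq nat) (m : nat) (i j : nat) : bool :=
  (j < nth 0 l i) && ~~ ((i == 0) && (j < m)).

(* Standard Young tableaux of skew shape lambda/(m): fillings of the cells by
   1..(number of cells) bijectively, strictly increasing along rows (left to
   right) and columns (top to bottom).  Outside the cells the filling is 0,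
   so that fillings are represented uniquely. *)
Definition is_skew_syt (l : seq nat) (m : nat)
    (T : {ffun 'I_(sumn l) * 'I_(sumn l) -> 'I_(sumn l).+1}) : bool :=
  let N := sumn l in
  let D := [set c : 'I_N * 'I_N | in_skew l m c.1 c.2] in
  [&& [forall c, (c \notin D) ==> (val (T c) == 0)],
      [forall c, (c \in D) ==> ((0 < T c) && (T c <= #|D|))],
      [forall c, forall c', [&& c \in D, c' \in D & T c == T c'] ==> (c == c')],
      [forall c, forall c', [&& c \in D, c' \in D, c.1 == c'.1 & (c.2 < c'.2)%N]
                              ==> (T c < T c')] &
      [forall c, forall c', [&& c \in D, c' \in D, c.2 == c'.2 & (c.1 < c'.1)%N]
                              ==> (T c < T c')]].

Arguments is_skew_syt : clear implicits.

(* f_{lambda/(m)}; f_{lambda/(0)} = f_lambda. (Zero when lambda_1 < m, since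
   then the skew shape is not defined.) *)
Definition f_skew (l : seq nat) (m : nat) : nat :=
  if m <= head 0 l then #|[set T : {ffun 'I_(sumn l) * 'I_(sumn l) -> 'I_(sumn l).+1} | is_skew_syt l m T]| else 0.
Definition f_shape (l : seq nat) : nat := f_skew l 0.

Fixpoint row_insert (t : seq (seq nat)) (x : nat) : seq (seq nat) :=
  match t with
  | [::] => [:: [:: x]]
  | r :: t' =>
      if has (fun y => x < y) r then
        let i := find (fun y => x < y) r in
        set_nth 0 r i x :: row_insert t' (nth 0 r i)
      else rcons r x :: t'
  end.

Definition rsk_P (w : seq nat) : seq (seq nat) := foldl row_insert [::] w.
Definition rsk_shape (w : seq nat) : seq nat := map size (rsk_P w).

(* Top to random shuffle: the deck is the sequence of cards read from top to
   bottom; remove the top card and insert it at position i (0 = top,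
   n-1 = bottom) among the n possible positions. *)
Definition top_to_random (d : seq nat) (i : nat) : seq nat :=
  match d with
  | [::] => [::]
  | x :: d' => take i d' ++ x :: drop i d'
  end.

Definition deck_after (n k : nat) (c : {ffun 'I_k -> 'I_n}) : seq nat :=
  foldl top_to_random (iota 1 n) [seq val (c i) | i <- enum 'I_k].

(* Probability that k successive top to random shuffles give shape lambda:
   all n^k choice sequences are equally likely. *)
Definition prob_shape (n k : nat) (l : seq nat) : rat :=
  (#|[set c : {ffun 'I_k -> 'I_n} | rsk_shape (deck_after c) == l]|%:R
  / (n ^ k)%:R)%R.

Definition P_occ (a k n : nat) : rat :=
  (#|[set f : {ffun 'I_k -> 'I_n} | #|f @: 'I_k| == a]|%:R / (n ^ k)%:R)%R.

(* Main.v *)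
Require Import Defs.
From mathcomp Require Import all_boot all_order all_algebra.
From mathcomp Require Import zify ring.

(* A deck in which [a] cards have been touched is uniform among the arrangements
   where the untouched cards [a+1..n] still appear in order, and the number of
   touched cards grows like the number of occupied boxes; so the number of choice
   sequences producing a given deck is a sum of Stirling numbers. Row insertion
   turns "the values above [a] appear in increasing order" into the same condition
   on the reading word of the insertion tableau, that is, the entries above [a]
   form a horizontal strip filled from left to right. Hence the decks of shape
   [l] are counted by [f_l] times the sum of [f_mu] over the horizontal strips
   [l/mu] of size [n-a]. Removing a box commutes with removing a horizontal
   strip, which identifies this sum with [f_(l/(n-a))]. *)

(** * Horizontal strips *)

(** Every count of tableaux becomes an iterate of [down], the adjoint of multiplication by $p_1$:
    $f_\lambda$ removes all boxes and counts the ways, while $f_{\lambda/(m)}$ removes all but $m$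
    boxes and asks that the row $(m)$ remain. Removing a horizontal strip of size $m$ is the adjoint
    of multiplication by $h_m$, so the identity that closes the count is $h_m p_1^a = p_1^a h_m$
    with $m = n-a$, paired with $s_\lambda$. It is proved directly on sequences of row lengths.
    Recording tableaux are never built: the words with a given insertion tableau are listed by
    reverse insertion, and their number is again an iterate of [down]. In these recursions rows that
    become empty are kept, so that shapes have constant length; row insertion starts from empty rows
    for the same reason. On the side of the balls, $S(k,a)\,n(n-1)\cdots(n-a+1)$ placements occupy
    exactly $a$ boxes, so $P(a,k,n)(n-a)!/n! = S(k,a)/n^k$. The factorials of the formula are this
    normalisation. *)

Definition corner (s : seq nat) (i : nat) : bool := nth 0 s i.+1 < nth 0 s i.
Definition dec (s : seq nat) (i : nat) : seq nat := set_nth 0 s i (nth 0 s i).-1.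
Definition inc (s : seq nat) (i : nat) : seq nat := set_nth 0 s i (nth 0 s i).+1.

Definition down (phi : seq nat -> nat) (s : seq nat) : nat :=
  \sum_(0 <= i < size s | corner s i) phi (dec s i).

Definition decreasing (s : seq nat) : Prop := forall i, nth 0 s i.+1 <= nth 0 s i.

Lemma corner_size s i : corner s i -> i < size s.
Proof.
by rewrite /corner; case: (ltnP i (size s)) => // h; rewrite [nth 0 s i]nth_default.
Qed.

Lemma nth_dec s i j : nth 0 (dec s i) j = nth 0 s j - (j == i).
Proof. by rewrite nth_set_nth /=; case: eqP => [->|]; lia. Qed.

Lemma nth_inc s i j : nth 0 (inc s i) j = nth 0 s j + (j == i).
Proof. by rewrite nth_set_nth /=; case: eqP => [->|]; lia. Qed.

Lemma size_dec s i : i < size s -> size (dec s i) = size s.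
Proof. by move=> h; rewrite size_set_nth (maxn_idPr h). Qed.

Lemma size_inc s i : i < size s -> size (inc s i) = size s.
Proof. by move=> h; rewrite size_set_nth (maxn_idPr h). Qed.

Lemma sumn_dec s i : corner s i -> sumn s = (sumn (dec s i)).+1.
Proof.
rewrite /corner => h.
have : 0 < nth 0 s i by lia.
elim: s i {h} => [|x s IH] [|i] //=; rewrite /dec /=.
  by lia.
by move=> h; rewrite (IH i h) /dec; lia.
Qed.

Lemma sumn_inc s i : i < size s -> sumn (inc s i) = (sumn s).+1.
Proof.
elim: s i => [|x s IH] [|i] //=; rewrite /inc /= ltnS => hi.
by rewrite (IH i hi) /inc; lia.
Qed.

Lemma decK s i : 0 < nth 0 s i -> inc (dec s i) i = s.
Proof.
move=> h; have hi : i < size s.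
  by rewrite ltnNge; apply: contraTN h => h; rewrite nth_default.
apply: (@eq_from_nth _ 0); first by rewrite size_inc size_dec.
by move=> j _; rewrite nth_inc nth_dec; case: eqP => [->|]; lia.
Qed.

Lemma incK s i : i < size s -> dec (inc s i) i = s.
Proof.
move=> hi; apply: (@eq_from_nth _ 0); first by rewrite size_dec size_inc.
by move=> j _; rewrite nth_dec nth_inc; case: eqP => [->|]; lia.
Qed.

Lemma decreasing_dec s i : decreasing s -> corner s i -> decreasing (dec s i).
Proof.
move=> hs hc j; rewrite !nth_dec; move: (hs j) hc; rewrite /corner.
by case: (j =P i) => [->|]; lia.
Qed.

Lemma decreasing_nth s i j : decreasing s -> i <= j -> nth 0 s j <= nth 0 s i.
Proof.
move=> hs /subnK <-; elim: (j - i) => // d IH.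
by rewrite addSn; apply: leq_trans (hs _) IH.
Qed.

Lemma sumn_nth_eq s t : size s = size t ->
  (forall i, nth 0 s i <= nth 0 t i) -> sumn s = sumn t -> s = t.
Proof.
elim: s t => [|x s IH] [|y t] //= [hs] hle hsum.
have h0 := hle 0; have hS i := hle i.+1; rewrite /= in h0 hS.
have hst : sumn s <= sumn t.
  elim: s t hs hS {IH hle hsum} => [|a s IH] [|b t] //= [hs] hS.
  by apply: leq_add (hS 0) (IH _ hs (fun i => hS i.+1)).
by rewrite (IH t hs hS); [congr cons|]; lia.
Qed.

(** After [k] removals only shapes of size [N] satisfying the invariant [Q] are reached, so
    agreement is asked for there alone. *)
Lemma iter_down_ext (Q : seq nat -> Prop) (N : nat) phi psi k s :
  (forall s i, Q s -> corner s i -> Q (dec s i)) ->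
  (forall s, Q s -> sumn s = N -> phi s = psi s) ->
  Q s -> sumn s = k + N -> iter k down phi s = iter k down psi s.
Proof.
move=> hQ hphi; elim: k s => [|k IH] s hs hn; first exact: hphi.
rewrite !iterS /down; apply: eq_bigr => i hi; apply: IH; first exact: hQ.
by move: (sumn_dec _ _ hi); lia.
Qed.

(* Boxes are removed one at a time, in weakly increasing rows starting from
   row [b]; every horizontal strip is removed in exactly one such way. *)
Fixpoint hstrips (m b : nat) (s : seq nat) : seq (seq nat) :=
  if m is m'.+1 then
    flatten [seq hstrips m' i (dec s i) | i <- iota b (size s - b) & corner s i]
  else [:: s].

(** Horizontal strips as interlacing row lengths; the last clause says that the strip avoids the
    first [b] rows. *)
Definition hstrip (b m : nat) (s r : seq nat) : bool :=
  [&& size r == size s, sumn s == sumn r + m,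
      all (fun i => nth 0 s i.+1 <= nth 0 r i <= nth 0 s i) (iota 0 (size s)) &
      all (fun i => nth 0 r i == nth 0 s i) (iota 0 b)].

Lemma hstripP b m s r :
  reflect [/\ size r = size s, sumn s = sumn r + m,
    forall i, nth 0 s i.+1 <= nth 0 r i <= nth 0 s i &
    forall i, i < b -> nth 0 r i = nth 0 s i] (hstrip b m s r).
Proof.
apply: (iffP and4P) => [[/eqP h1 /eqP h2 /allP h3 /allP h4]|[h1 h2 h3 h4]]; split.
- by [].
- by [].
- move=> i; case: (ltnP i (size s)) => hi; first by apply: h3; rewrite mem_iota.
  by rewrite !nth_default //; [rewrite h1|apply: leq_trans hi _].
- by move=> i hi; apply/eqP/h4; rewrite mem_iota.
- exact/eqP.
- exact/eqP.
- by apply/allP => i _; apply: h3.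
- by apply/allP => i; rewrite mem_iota => hi; apply/eqP/h4.
Qed.

Lemma count_flatten_map (T S : Type) (P : pred S) (F : T -> seq S) (s : seq T) :
  count P (flatten [seq F i | i <- s]) = \sum_(i <- s) count P (F i).
Proof. by elim: s => [|x s IH]; rewrite ?big_nil ?big_cons //= count_cat IH. Qed.

Lemma sum_nat_uniq_true (I : eqType) (r : seq I) (P : pred I) i :
  uniq r -> i \in r -> P i -> (forall j, j \in r -> P j -> j = i) ->
  \sum_(j <- r) (P j : nat) = 1.
Proof.
move=> hu hi hP hj; rewrite (bigD1_seq i) //= hP big1_seq ?addn0 // => j /andP[hne hjr].
by case hPj: (P j) => //; rewrite (hj j hjr hPj) eqxx in hne.
Qed.

(** The conclusions identify [i] from [s] and [r] alone, as the first row in which they differ. This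
    is why a strip occurs only once in [hstrips]. *)
Lemma hstrip_decP b m s r i : decreasing s -> b <= i -> corner s i ->
  hstrip i m (dec s i) r ->
  [/\ hstrip b m.+1 s r, nth 0 r i < nth 0 s i & forall j, j < i -> nth 0 r j = nth 0 s j].
Proof.
move=> hs hbi hc /hstripP[h1 h2 h3 h4].
have hi := corner_size _ _ hc.
have hne j : j < i -> nth 0 r j = nth 0 s j.
  by move=> hj; rewrite h4 // nth_dec; lia.
have hlt : nth 0 r i < nth 0 s i.
  by move: (h3 i) hc; rewrite !nth_dec /corner; lia.
split => //; apply/hstripP; split.
- by rewrite h1 size_dec.
- by rewrite (sumn_dec _ _ hc) h2 addnS.
- move=> j; move: (h3 j); rewrite !nth_dec; case: (ltnP j i) => hj; last by lia.
  by rewrite hne // leqnn hs.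
- by move=> j hj; apply: hne; lia.
Qed.

Lemma count_hstrips m b s r : decreasing s ->
  count_mem r (hstrips m b s) = hstrip b m s r.
Proof.
elim: m b s => [|m IH] b s hs.
  rewrite /= addn0; congr nat_of_bool; apply/eqP/hstripP => [<-|[h1 h2 h3 _]].
    by split; rewrite ?addn0 // => i; rewrite hs leqnn.
  apply/esym/sumn_nth_eq => //; last by lia.
  by move=> i; case/andP: (h3 i).
rewrite /= count_flatten_map big_filter big_mkcond /=.
under eq_bigr => i _.
  have -> : (if corner s i then count_mem r (hstrips m i (dec s i)) else 0) =
            ((corner s i && hstrip i m (dec s i) r) : nat).
    by case: ifP => // hc; rewrite IH //; apply: decreasing_dec.
  over.
case E: (hstrip b m.+1 s r); last first.
  apply: big1_seq => i /=; rewrite mem_iota => hi; apply/eqP; rewrite eqb0.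
  have hbi : b <= i. move: hi; lia.
  apply/negP => /andP[hc hh].
  by case: (hstrip_decP b _ _ _ _ hs hbi hc hh); rewrite E.
case/hstripP: E => h1 h2 h3 h4.
pose P i := nth 0 r i < nth 0 s i.
have hasP : has P (iota 0 (size s)).
  apply/negPn/negP => /hasPn hn.
  suff : r = s by move=> ers; move: h2; rewrite ers; lia.
  apply: (@eq_from_nth _ 0) => // i; rewrite h1 => hi.
  have := hn i; rewrite mem_iota /P => /(_ hi); move: (h3 i); lia.
(* The topmost row that loses a box must lose one first. It is a corner because interlacing bounds
   the next row of [s] by the shortened row. *)
set i := find P (iota 0 (size s)).
have hi : i < size s by rewrite -[X in _ < X](size_iota 0) -has_find.
have hPi : P i by have := nth_find 0 hasP; rewrite nth_iota // -has_find.
have hlti j : j < i -> nth 0 r j = nth 0 s j.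
  move=> hj; have := before_find 0 hj; rewrite nth_iota; last by lia.
  by rewrite /P add0n; move: (h3 j); lia.
have hbi : b <= i.
  by rewrite leqNgt; apply/negP => hib; move: hPi; rewrite /P h4 // ltnn.
have hc : corner s i by move: hPi (h3 i); rewrite /P /corner; lia.
rewrite (sum_nat_uniq_true _ _ _ i) ?iota_uniq //.
- by rewrite mem_iota; lia.
- rewrite hc; apply/hstripP; split.
  + by rewrite size_dec.
  + by move: (sumn_dec _ _ hc); lia.
  + move=> j; rewrite !nth_dec; move: (h3 j) hPi; rewrite /P.
    by case: (j =P i) => [->|]; lia.
  + by move=> j hj; rewrite nth_dec hlti //; lia.
- move=> j; rewrite mem_iota => hj /andP[hcj hh].
  have hbj : b <= j by lia.
  have [_ hlt heq] := hstrip_decP b _ _ _ _ hs hbj hcj hh.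
  case: (ltngtP j i) => // hji.
    by move: hlt; rewrite hlti ?ltnn.
  by move: hPi; rewrite /P heq ?ltnn.
Qed.

Lemma mem_hstrips m b s r : decreasing s -> (r \in hstrips m b s) = hstrip b m s r.
Proof. by move=> hs; rewrite -has_pred1 has_count count_hstrips // lt0b. Qed.

(* If [s/r] is a horizontal strip then box [i] can be removed first from [s] iff
   it can be added to [r]. Otherwise [s/r] contains a single vertical domino, in
   rows [i] and [i.+1], and the box in row [i.+1] on the left corresponds to the
   box in row [i] on the right. *)
Lemma hstrip_exchange m s r : decreasing s -> size r = size s ->
  \sum_(0 <= i < size s) (corner s i && hstrip 0 m (dec s i) r : nat) =
  \sum_(0 <= i < size s) (corner (inc r i) i && hstrip 0 m s (inc r i) : nat).
Proof.
move=> hs hsz.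
have sumnI i : i < size s -> sumn (inc r i) = (sumn r).+1.
  by rewrite -hsz; apply: sumn_inc.
pose A i := corner s i && hstrip 0 m (dec s i) r.
pose B i := corner (inc r i) i && hstrip 0 m s (inc r i).
(* Both indicators become interlacing of [s] and [r] with a slack of one box: [A i] allows it
   between rows [i-1] and [i], [B i] between rows [i] and [i+1]. Hence the shift by one row when the
   slack is really used. *)
have AP i : i < size s -> reflect [/\ sumn s = sumn r + m.+1, nth 0 r i < nth 0 s i &
    forall j, nth 0 s j.+1 <= nth 0 r j + (j.+1 == i) /\ nth 0 r j <= nth 0 s j] (A i).
  move=> hi; apply: (iffP andP) => [[hc /hstripP[h1 h2 h3 _]]|[h1 h2 h3]].
    split; first by rewrite (sumn_dec _ _ hc) h2 addnS.
      by move: (h3 i) hc; rewrite !nth_dec /corner; lia.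
    by move=> j; move: (h3 j); rewrite !nth_dec; lia.
  have hc : corner s i.
    rewrite /corner; case: (h3 i) => + _; lia.
  split=> //; apply/hstripP; split=> //.
  - by rewrite size_dec.
  - by move: (sumn_dec _ _ hc); lia.
  - move=> j; rewrite !nth_dec; move: (h3 j).
    by case: (j =P i) => [->|]; lia.
have BP i : i < size s -> reflect [/\ sumn s = sumn r + m.+1, nth 0 r i < nth 0 s i, nth 0 r i.+1 <= nth 0 r i &
    forall j, nth 0 s j.+1 <= nth 0 r j + (j == i) /\ nth 0 r j <= nth 0 s j] (B i).
  move=> hi; apply: (iffP andP) => [[+ /hstripP[h1 h2 h3 _]]|[h1 h2 h3 h4]].
    rewrite /corner !nth_inc => hc.
    split; first by rewrite h2 sumnI; lia.
    - by move: (h3 i); rewrite !nth_inc; lia.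
    - lia.
    - by move=> j; move: (h3 j); rewrite !nth_inc; lia.
  split; first by rewrite /corner !nth_inc; lia.
  apply/hstripP; split=> //.
  - by rewrite size_inc hsz.
  - by rewrite sumnI //; lia.
  - move=> j; rewrite !nth_inc; move: (h4 j).
    by case: (j =P i) => [->|]; lia.
case E: (hstrip 0 m.+1 s r).
  case/hstripP: E => _ h2 h3 _.
  rewrite !big_nat; apply: eq_bigr => i /andP[_ hi]; congr nat_of_bool.
  apply/idP/idP => [/(AP i hi)[g1 g2 g3]|/(BP i hi)[g1 g2 g3 g4]].
    apply/(BP i hi); split=> //; first by move: (h3 i) (h3 i.+1); lia.
    by move=> j; move: (h3 j); lia.
  by apply/(AP i hi); split=> // j; move: (h3 j); lia.
have nE : sumn s = sumn r + m.+1 -> (forall j, nth 0 r j <= nth 0 s j) ->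
    ~ forall j, nth 0 s j.+1 <= nth 0 r j.
  move=> h1 h2 h3; move/negbT/hstripP: E; apply; split=> //.
  by move=> i; rewrite h2 h3.
rewrite -/A -/B; case hN: (size s) AP BP => [|N] AP BP.
  by rewrite !big_geq.
(* The shift leaves the two end terms unmatched. They vanish: a domino would need a row above row 0
   or a nonempty row below the last one. *)
rewrite big_nat_recl // big_nat_recr //= -/(A 0) -/(B N).
have -> : A 0 = false.
  apply/negP => /(AP 0 isT)[g1 g2 g3]; apply: (nE g1) => j; move: (g3 j); lia.
have -> : B N = false.
  apply/negP => /(BP N (ltnSn N))[g1 g2 g3 g4]; apply: (nE g1) => j; move: (g4 j); first by lia.
  by case: (j =P N) => [->|] /=; [rewrite [nth 0 s N.+1]nth_default ?hN|lia].
rewrite addn0 add0n !big_nat; apply: eq_bigr => i /andP[_ hi]; congr nat_of_bool.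
have hi1 : i.+1 < N.+1 by [].
have hi0 : i < N.+1 by lia.
apply/idP/idP => [/(AP _ hi1)[g1 g2 g3]|/(BP _ hi0)[g1 g2 g3 g4]].
  (* Since [s/r] is not a horizontal strip the slack is attained: rows [i] and [i.+1] overlap in
     exactly one column. *)
  have gi : nth 0 s i.+1 = (nth 0 r i).+1.
    apply/eqP; rewrite eqn_leq; apply/andP; split; first by move: (g3 i); lia.
    rewrite ltnNge; apply/negP => hle; apply: (nE g1) => j; move: (g3 j); first by lia.
    by case: (j =P i) => [->|]; lia.
  apply/(BP _ hi0); split; [done|by move: (hs i); lia|by lia|].
  by move=> j; move: (g3 j); lia.
have gi : nth 0 s i.+1 = (nth 0 r i).+1.
  apply/eqP; rewrite eqn_leq; apply/andP; split; first by move: (g4 i); lia.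
  rewrite ltnNge; apply/negP => hle; apply: (nE g1) => j; move: (g4 j); first by lia.
  by case: (j =P i) => [->|]; lia.
apply/(AP _ hi1); split; [done|by lia|].
by move=> j; move: (g4 j); lia.
Qed.

(** Commutation of the adjoints of $p_1$ and $h_m$. Both sides sum [phi] over a list of shapes, so
    it suffices that each [r] has the same multiplicity in the two lists, which is
    [hstrip_exchange]. *)
Lemma down_hstrips m s phi : decreasing s ->
  down (fun t => \sum_(r <- hstrips m 0 t) phi r) s =
  \sum_(t <- hstrips m 0 s) down phi t.
Proof.
move=> hs; pose dn t := [seq dec t i | i <- iota 0 (size t) & corner t i].
have dnE psi t : down psi t = \sum_(r <- dn t) psi r.
  by rewrite big_map big_filter /down /index_iota subn0.
rewrite dnE (eq_bigr _ (fun t _ => dnE phi t)).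
have fl (F : seq nat -> seq (seq nat)) (l : seq (seq nat)) :
    \sum_(t <- l) \sum_(r <- F t) phi r = \sum_(r <- flatten (map F l)) phi r.
  by elim: l => [|t l IH]; rewrite ?big_nil //= big_cons IH big_cat.
rewrite !fl; apply: perm_big; apply/allP => r _; apply/eqP.
rewrite !count_flatten_map /dn big_map big_filter.
have hszs t : t \in hstrips m 0 s -> size t = size s.
  by rewrite mem_hstrips // => /hstripP[].
transitivity (\sum_(0 <= i < size s) (corner s i && hstrip 0 m (dec s i) r : nat)).
  rewrite /index_iota subn0 big_mkcond; apply: eq_bigr => i _.
  by case: ifP => // hc; rewrite count_hstrips //; apply: decreasing_dec.
transitivity (\sum_(t <- hstrips m 0 s) \sum_(0 <= i < size s)
    ((corner t i && (dec t i == r)) : nat)); last first.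
  apply: eq_big_seq => t ht; rewrite count_map count_filter -(hszs t ht).
  rewrite /index_iota subn0 -sum1_count [RHS]big_mkcond /=; apply: eq_bigr => i _.
  by rewrite andbC; case: ifP.
rewrite exchange_big /=.
case: (size r =P size s) => hsz; last first.
  rewrite !big_nat !big1 // => i /andP[_ hi].
    rewrite big1_seq // => t /andP[_ ht]; apply/eqP; rewrite eqb0.
    by apply/negP => /andP[_ /eqP hd]; apply: hsz; rewrite -hd size_dec hszs.
  by apply/eqP; rewrite eqb0; apply/negP => /andP[hc /hstripP[]]; rewrite size_dec.
rewrite hstrip_exchange // !big_nat; apply: eq_bigr => i /andP[_ hi].
have -> : \sum_(t <- hstrips m 0 s) (corner t i && (dec t i == r) : nat) =
    \sum_(t <- hstrips m 0 s) (corner (inc r i) i && (t == inc r i) : nat).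
  apply: eq_bigr => t _; congr nat_of_bool.
  apply/andP/andP => [[hc /eqP <-]|[hc /eqP ->]].
    by rewrite decK; [|move: hc; rewrite /corner; lia].
  by rewrite hc incK ?hsz.
case: (corner _ _) => /=; last by rewrite big1.
by rewrite -count_hstrips // -sum1_count big_mkcond.
Qed.

Lemma iter_down_hstrips k m s phi : decreasing s ->
  \sum_(t <- hstrips m 0 s) iter k down phi t =
  iter k down (fun t => \sum_(r <- hstrips m 0 t) phi r) s.
Proof.
elim: k s phi => [//|k IH] s phi hs.
rewrite -down_hstrips // iterS /down; apply: eq_bigr => i hc.
by apply: IH; apply: decreasing_dec.
Qed.

Lemma nth_leq_sumn s i : nth 0 s i <= sumn s.
Proof.
elim: s i => [|x s IH] [|i] //=; first exact: leq_addr.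
exact: leq_trans (IH i) (leq_addl _ _).
Qed.

(** Only the empty shape can be left, and the whole of [s] is a horizontal strip exactly when [s] is
    a single row. *)
Lemma hstrips_row m s : decreasing s -> sumn s = m ->
  \sum_(r <- hstrips m 0 s) 1 = (m <= nth 0 s 0).
Proof.
move=> hs hsum; rewrite sum1_size.
have hz r : r \in hstrips m 0 s -> r = nseq (size s) 0.
  rewrite mem_hstrips // => /hstripP[h1 h2 _ _].
  apply: sumn_nth_eq => [|i|]; rewrite ?size_nseq ?sumn_nseq //; last by lia.
  by rewrite nth_nseq if_same; move: (nth_leq_sumn r i); lia.
have -> : size (hstrips m 0 s) = count_mem (nseq (size s) 0) (hstrips m 0 s).
  by apply/esym/eqP; rewrite -all_count; apply/allP => r /hz ->; rewrite /= eqxx.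
rewrite count_hstrips //; congr nat_of_bool.
case: s hs hsum {hz} => [|x s] hs hsum; first by rewrite -hsum.
rewrite /= in hsum; rewrite [nth _ _ 0]/=.
apply/hstripP/idP => [[_ _ h _]|hm].
  suff : sumn s <= 0 by lia.
  have : forall i, nth 0 s i <= 0.
    by move=> i; have := h i; rewrite nth_nseq if_same => /andP[].
  elim: s {hs hsum h} => [|y s IH] //= h.
  by have := h 0; have := IH (fun i => h i.+1); rewrite /=; lia.
split; rewrite ?size_nseq ?sumn_nseq //.
move=> i; rewrite nth_nseq if_same /= andbT.
by move: (nth_leq_sumn s i); lia.
Qed.

(** * Skew standard tableaux *)

Lemma bij_on_card (T U : finType) (A : {set T}) (B : {set U}) (F : T -> U) (G : U -> T) :
  (forall x, x \in A -> F x \in B /\ G (F x) = x) ->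
  (forall y, y \in B -> G y \in A /\ F (G y) = y) -> #|A| = #|B|.
Proof.
move=> hF hG; rewrite -(card_in_imset (f := F) (D := A)).
  congr #|pred_of_set _|; apply/setP => y; apply/imsetP/idP => [[x /hF[h _] ->] //|].
  by case/hG => h1 h2; exists (G y).
by move=> x y /hF[_ hx] /hF[_ hy] e; rewrite -hx e hy.
Qed.

Definition skew_cells (N : nat) (l : seq nat) (m : nat) : {set 'I_N * 'I_N} :=
  [set c : 'I_N * 'I_N | in_skew l m c.1 c.2].

(** The size [N] of the ambient square and of the value range is separated from [sumn l], so that
    both stay fixed while boxes are removed from [l]. *)
Definition skew_syt (N : nat) (l : seq nat) (m : nat)
    (T : {ffun 'I_N * 'I_N -> 'I_N.+1}) : bool :=
  let D := skew_cells N l m in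
  [&& [forall c, (c \notin D) ==> (val (T c) == 0)],
      [forall c, (c \in D) ==> ((0 < T c) && (T c <= #|D|))],
      [forall c, forall c', [&& c \in D, c' \in D & T c == T c'] ==> (c == c')],
      [forall c, forall c', [&& c \in D, c' \in D, c.1 == c'.1 & (c.2 < c'.2)%N]
                              ==> (T c < T c')] &
      [forall c, forall c', [&& c \in D, c' \in D, c.2 == c'.2 & (c.1 < c'.1)%N]
                              ==> (T c < T c')]].

Lemma skew_sytP N l m (T : {ffun 'I_N * 'I_N -> 'I_N.+1}) : let D := skew_cells N l m in
  reflect [/\ forall c, c \notin D -> T c = ord0,
              forall c, c \in D -> 0 < T c <= #|D|,
              {in D &, injective T},
              forall c c', c \in D -> c' \in D -> c.1 = c'.1 -> c.2 < c'.2 -> T c < T c' &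
              forall c c', c \in D -> c' \in D -> c.2 = c'.2 -> c.1 < c'.1 -> T c < T c']
          (skew_syt N l m T).
Proof.
move=> D; apply: (iffP and5P) => [[h1 h2 h3 h4 h5]|[h1 h2 h3 h4 h5]]; split.
- by move=> c hc; apply/val_inj/eqP; move/forallP: h1 => /(_ c) /implyP; apply.
- by move=> c hc; move/forallP: h2 => /(_ c) /implyP; apply.
- move=> c c' hc hc' e; apply/eqP; move/forallP: h3 => /(_ c) /forallP /(_ c') /implyP; apply.
  by rewrite hc hc' e eqxx.
- move=> c c' hc hc' e e'; move/forallP: h4 => /(_ c) /forallP /(_ c') /implyP; apply.
  by rewrite hc hc' e eqxx.
- move=> c c' hc hc' e e'; move/forallP: h5 => /(_ c) /forallP /(_ c') /implyP; apply.
  by rewrite hc hc' e eqxx.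
- by apply/forallP => c; apply/implyP => hc; rewrite h1.
- by apply/forallP => c; apply/implyP => hc; rewrite h2.
- apply/forallP => c; apply/forallP => c'; apply/implyP => /and3P[hc hc' /eqP e].
  by apply/eqP/h3.
- apply/forallP => c; apply/forallP => c'; apply/implyP => /and4P[hc hc' /eqP e e'].
  exact: h4.
- apply/forallP => c; apply/forallP => c'; apply/implyP => /and4P[hc hc' /eqP e e'].
  exact: h5.
Qed.

Definition skew_syt_num (N : nat) (l : seq nat) (m : nat) : nat :=
  if m <= nth 0 l 0 then #|[set T | skew_syt N l m T]| else 0.

Lemma f_skewE l m : f_skew l m = skew_syt_num (sumn l) l m.
Proof. by rewrite /f_skew /skew_syt_num nth0; case: ifP => // _; apply: eq_card. Qed.

Lemma sum_ord_nth N (l : seq nat) : size l <= N -> \sum_(i < N) nth 0 l i = sumn l.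
Proof.
move=> h; rewrite sumnE (big_nth 0) big_mkord (big_ord_widen N (nth 0 l) h).
rewrite [LHS](bigID (fun i : 'I_N => i < size l)) /= [X in _ + X]big1 ?addn0 //.
by move=> i hi; rewrite nth_default // leqNgt.
Qed.

Lemma sum_ord_ltn N a : a <= N -> \sum_(j < N) (j < a : nat) = a.
Proof.
move=> h; rewrite -[RHS]card_ord -sum1_card (big_ord_widen N (fun=> 1) h) [RHS]big_mkcond /=.
by apply: eq_bigr => j _; case: (j < a).
Qed.

Lemma card_skew_cells N l m : size l <= N -> (forall i, nth 0 l i <= N) ->
  m <= nth 0 l 0 -> #|skew_cells N l m| + m = sumn l.
Proof.
move=> hsz hN hm; rewrite cardsE -sum1_card big_mkcond /=.
rewrite -(pair_bigA _ (fun i j : 'I_N => if in_skew l m i j then 1 else 0)) /=.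
rewrite -(sum_ord_nth N l hsz).
rewrite (eq_bigr (fun i : 'I_N => nth 0 l i - (i == 0 :> nat) * m)) => [|i _].
  case: N hsz hN => [|N] hsz hN; first by rewrite !big_ord0 add0n; move: (hN 0); lia.
  rewrite !big_ord_recl addnAC /= mul1n subnK //; congr addn.
  by apply: eq_bigr => i _; rewrite mul0n subn0.
apply/eqP; rewrite -(eqn_add2r ((i == 0 :> nat) * m)) subnK; last first.
  by case: (val i =P 0) => [->|]; rewrite ?mul1n ?mul0n.
rewrite -[X in _ == X](sum_ord_ltn N) //.
rewrite -[X in _ + X](sum_ord_ltn N); last by move: (hN 0); case: (val i == 0); lia.
rewrite -big_split /=; apply/eqP/eq_bigr => j _; rewrite /in_skew.
by case: (val i =P 0) => [->|_] /=; rewrite ?mul1n ?mul0n;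
  case: (ltnP j (nth 0 l _)); case: (ltnP j m) => //=; lia.
Qed.

(** * Deleting the largest entry of a skew tableau *)

Section RemoveCorner.

Variables (N m : nat) (l : seq nat).
Hypotheses (hdec : decreasing l) (hsz : size l <= N) (hN : forall i, nth 0 l i <= N).
Hypotheses (hm : m <= nth 0 l 0) (hsum : sumn l <= N).

Let D := skew_cells N l m.
Let K := #|D|.
Local Notation filling := {ffun 'I_N * 'I_N -> 'I_N.+1}.

Lemma corner_bounds i : corner l i -> (i < N) * ((nth 0 l i).-1 < N).
Proof.
move=> hc; have := corner_size _ _ hc; have := hN i; move: hc; rewrite /corner.
by split; lia.
Qed.

Lemma in_skew_dec i a b : 0 < nth 0 l i ->
  in_skew (dec l i) m a b = in_skew l m a b && ~~ ((a == i) && (b == (nth 0 l i).-1)).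
Proof.
move=> h; rewrite /in_skew nth_dec; case: (a =P i) => [->|_] /=; last by rewrite subn0 andbT.
lia.
Qed.

(** Pigeonhole: if [K] were missed, [K] distinct entries would lie in [1..K-1]. *)
Lemma skew_syt_max T : 0 < K -> skew_syt N l m T ->
  exists2 c, c \in D & T c = K :> nat.
Proof.
move=> hK /skew_sytP[_ h2 h3 _ _].
case: (boolP [exists c in D, T c == K :> nat]) => [/exists_inP[c hc /eqP e]|].
  by exists c.
rewrite negb_exists_in => /forall_inP hne; exfalso.
have hu : uniq [seq (T c : nat) | c <- enum D].
  rewrite map_inj_in_uniq ?enum_uniq // => c c'; rewrite !mem_enum => hc hc' /val_inj.
  exact: h3.
have hsub : {subset [seq (T c : nat) | c <- enum D] <= iota 1 K.-1}.
  move=> x /mapP[c]; rewrite mem_enum => hc ->; rewrite mem_iota.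
  by move: (h2 c hc) (hne c hc); rewrite -/K; lia.
by have := uniq_leq_size hu hsub; rewrite size_map -cardE size_iota -/K; lia.
Qed.

(** A cell to the right of [c] or below it would carry an entry larger than [K]. The third
    conclusion holds because a cell of row 0 lies beyond the [m] excluded cells; it keeps the
    smaller skew shape defined. *)
Lemma skew_syt_max_corner T c : skew_syt N l m T -> c \in D -> T c = K :> nat ->
  [/\ corner l c.1, c.2 = (nth 0 l c.1).-1 :> nat & m <= nth 0 (dec l c.1) 0].
Proof.
case: c => i j /skew_sytP[_ h2 _ h4 h5] hc hT.
have := hc; rewrite inE /in_skew /= => /andP[hj hm0].
have hle c' : c' \in D -> T c' <= K by case/h2/andP.
have h1 : nth 0 l i <= j.+1.
  rewrite leqNgt; apply/negP => hlt.
  have hj1 : j.+1 < N by apply: leq_trans hlt (hN i).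
  have hc' : (i, Ordinal hj1) \in D by rewrite inE /in_skew /=; lia.
  by have := h4 _ _ hc hc' erefl (ltnSn j); rewrite hT ltnNge hle.
have h6 : nth 0 l i.+1 <= j.
  rewrite leqNgt; apply/negP => hlt.
  have hi1 : i.+1 < N.
    by rewrite ltnNge; apply/negP => h; move: hlt; rewrite nth_default //; lia.
  have hc' : (Ordinal hi1, j) \in D by rewrite inE /in_skew /=; lia.
  by have := h5 _ _ hc hc' erefl (ltnSn i); rewrite hT ltnNge hle.
split=> /=; first by rewrite /corner; lia.
  by lia.
rewrite nth_dec; case: (posnP i) => hi0; last by rewrite ltn_eqF // subn0.
by move: hm0 hj; rewrite hi0 /=; lia.
Qed.

Variable c : 'I_N * 'I_N.
Hypotheses (hc : corner l c.1) (hc2 : c.2 = (nth 0 l c.1).-1 :> nat).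
Hypothesis hmc : m <= nth 0 (dec l c.1) 0.

Let D' := skew_cells N (dec l c.1) m.

Lemma skew_cells_dec : D' = D :\ c.
Proof.
apply/setP => -[a b]; rewrite !inE in_skew_dec; last by move: hc; rewrite /corner; lia.
rewrite /= andbC; congr (~~ _ && _); case: c hc2 => c1 c2 /= <-.
by rewrite -[RHS]/((a == c1) && (b == c2)).
Qed.

Lemma corner_mem : c \in D.
Proof.
rewrite inE /in_skew; move: hc hmc hc2; rewrite /corner nth_dec.
case: (c.1 =P 0 :> nat) => [->|] /=; first by lia.
by lia.
Qed.

Lemma card_skew_cells_dec : K = #|D'|.+1.
Proof. by rewrite skew_cells_dec /K (cardsD1 c) corner_mem. Qed.

Lemma card_skew_syt_max :
  #|[set T : filling | skew_syt N l m T & T c == K :> nat]| =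
  #|[set T : filling | skew_syt N (dec l c.1) m T]|.
Proof.
have hKN : K < N.+1 by rewrite ltnS; move: (card_skew_cells N l m hsz hN hm); rewrite -/D -/K; lia.
(* The bijection erases the entry [K] at [c], and its inverse writes it back; 0 is the value
   prescribed outside the cells. *)
pose F (T : filling) : filling := [ffun d => if d == c then ord0 else T d].
pose G (T : filling) : filling := [ffun d => if d == c then Ordinal hKN else T d].
have hD' d : (d \in D') = (d != c) && (d \in D) by rewrite skew_cells_dec !inE.
have hcD := corner_mem; have hK := card_skew_cells_dec.
apply: (bij_on_card _ _ _ _ F G) => T; rewrite !inE.
  case/andP => /skew_sytP[h1 h2 h3 h4 h5] /eqP hT; split; last first.
    apply/ffunP => d; rewrite !ffunE; case: (d =P c) => [->|//].
    by apply: val_inj; rewrite /= hT.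
  apply/skew_sytP; split.
  - move=> d; rewrite hD' ffunE negb_and negbK.
    by case: (d =P c) => //= _; apply: h1.
  - move=> d; rewrite hD' ffunE => /andP[/negbTE hd hdD]; rewrite hd.
    case/andP: (h2 d hdD) => -> /=; rewrite -/D -/K -/D' leq_eqVlt hK ltnS => /orP[/eqP e|//].
    by move: (h3 d c hdD hcD); rewrite (_ : T d = T c) => [/(_ erefl) e'|];
      [rewrite e' eqxx in hd|apply: val_inj; rewrite /= e hT hK].
  - move=> d d'; rewrite !hD' !ffunE => /andP[/negbTE -> hd] /andP[/negbTE -> hd'].
    exact: h3.
  - move=> d d'; rewrite !hD' !ffunE => /andP[/negbTE -> hd] /andP[/negbTE -> hd'].
    exact: h4.
  - move=> d d'; rewrite !hD' !ffunE => /andP[/negbTE -> hd] /andP[/negbTE -> hd'].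
    exact: h5.
move/skew_sytP => [h1 h2 h3 h4 h5]; split; last first.
  apply/ffunP => d; rewrite !ffunE; case: (d =P c) => [->|//].
  by rewrite h1 // -/D' hD' eqxx.
have hlt d : d \in D -> d != c -> T d < K.
  move=> hd hdc; have /andP[_ hle] : 0 < T d <= #|D'| by apply: h2; rewrite -/D' hD' hd hdc.
  by rewrite hK ltnS.
rewrite ffunE eqxx /= eqxx andbT; apply/skew_sytP; split.
- move=> d hd; rewrite ffunE; case: (d =P c) hd => [->|/eqP hdc hd]; first by rewrite hcD.
  by rewrite h1 // -/D' hD' negb_and hd orbT.
- move=> d hd; rewrite ffunE -/D -/K; case: (d =P c) => [_|/eqP hdc] /=; first by lia.
  have /andP[-> _] : 0 < T d <= #|D'| by apply: h2; rewrite -/D' hD' hd hdc.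
  exact: ltnW (hlt d hd hdc).
- move=> d d' hd hd'; rewrite !ffunE.
  case: (d =P c) => [->|/eqP hdc]; case: (d' =P c) => [->|/eqP hdc'] // e.
  + by have := hlt d' hd' hdc'; rewrite -e /= ltnn.
  + by have := hlt d hd hdc; rewrite e /= ltnn.
  + by apply: h3 => //; rewrite -/D' hD' ?hd ?hdc ?hd' ?hdc'.
- move=> d d' hd hd' e1 e2; rewrite !ffunE.
  case: (d =P c) => [ed|/eqP hdc]; case: (d' =P c) => [ed'|/eqP hdc'].
  + by rewrite ed ed' ltnn in e2.
  + exfalso; move: hd'; rewrite inE /in_skew -e1 ed => /andP[e3 _].
    by move: e2 e3; rewrite ed hc2; case: (nth 0 l c.1) => //= x ha hb; move: (leq_trans ha hb); rewrite ltnn.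
  + exact: hlt.
  + by apply: h4 => //; rewrite -/D' hD' ?hd ?hdc ?hd' ?hdc'.
- move=> d d' hd hd' e1 e2; rewrite !ffunE.
  case: (d =P c) => [ed|/eqP hdc]; case: (d' =P c) => [ed'|/eqP hdc'].
  + by rewrite ed ed' ltnn in e2.
  + exfalso; move: hd'; rewrite inE /in_skew -e1 ed => /andP[e3 _].
    move: e2; rewrite ed => e2; move: (decreasing_nth _ _ _ hdec e2) (hc) e3.
    rewrite hc2 /corner; case: (nth 0 l c.1) => //= x g1 g2 g3.
    by move: (leq_trans (leq_trans g3 g1) g2); rewrite ltnn.
  + exact: hlt.
  + by apply: h5 => //; rewrite -/D' hD' ?hd ?hdc ?hd' ?hdc'.
Qed.

End RemoveCorner.

Lemma skew_syt_num_down N l m : decreasing l -> size l <= N -> (forall i, nth 0 l i <= N) ->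
  sumn l <= N -> m < sumn l ->
  skew_syt_num N l m = down (fun t => skew_syt_num N t m) l.
Proof.
move=> hdec hsz hN hsum hlt; rewrite {1}/skew_syt_num; case: ifP => hm; last first.
  rewrite /down big1 // => i _; rewrite /skew_syt_num nth_dec; case: ifP => //.
  by move: hm; lia.
have hK : 0 < #|skew_cells N l m| by move: (card_skew_cells N l m hsz hN hm); lia.
rewrite /down /skew_syt_num.
have hcell i : corner l i -> {c : 'I_N * 'I_N | c.1 = i :> nat & c.2 = (nth 0 l i).-1 :> nat}.
  by move=> /(corner_bounds N m l hsz hN hm hsum)[h1 h2]; exists (Ordinal h1, Ordinal h2).
pose S := [set T | skew_syt N l m T].
(* [M i T] says that the largest entry of [T] sits at the end of row [i]. Exchanging the sums
   leaves, for each tableau, the claim that exactly one corner qualifies. *)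
pose M i (T : {ffun 'I_N * 'I_N -> 'I_N.+1}) := (m <= nth 0 (dec l i) 0) &&
  [exists c : 'I_N * 'I_N, [&& c.1 == i :> nat, c.2 == (nth 0 l i).-1 :> nat & T c == #|skew_cells N l m| :> nat]].
rewrite (eq_bigr (fun i => \sum_(T in S) (M i T : nat))); last first.
  move=> i hc; case: (hcell i hc) => c e1 e2; rewrite /M; case: ifP => hmc; last by rewrite big1.
  rewrite -e1 in hc hmc e2 *; rewrite -card_skew_syt_max //.
  rewrite -sum1_card [RHS]big_mkcond [LHS]big_mkcond; apply: eq_bigr => T _; rewrite !inE.
  case: (skew_syt _ _ _ _) => //=.
  case: (T c =P #|skew_cells N l m| :> nat) => hT; first by rewrite (_ : [exists _, _]) //; apply/existsP; exists c; rewrite e2 hT !eqxx.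
  case: existsP => // -[d /and3P[/eqP d1 /eqP d2 /eqP d3]].
  case: hT; rewrite (_ : c = d) //; case: c d e2 d1 d2 {d3 hc hmc e1} => [a b] [a' b'] /= hb ha' hb'.
  by congr pair; apply: val_inj => //=; rewrite hb hb'.
rewrite -sum1_card exchange_big /=; apply: eq_bigr => T; rewrite inE => hT.
have [c hcD hTc] := skew_syt_max N m l hsz hm hsum T hK hT.
have [h1 h2 h3] := skew_syt_max_corner N m l hsz hN hm hsum T c hT hcD hTc.
rewrite -big_filter; apply/esym.
apply: (sum_nat_uniq_true _ _ _ (val c.1)).
- by rewrite filter_uniq // iota_uniq.
- by rewrite mem_filter h1 mem_index_iota corner_size.
- by rewrite /M h3; apply/existsP; exists c; rewrite h2 hTc !eqxx.
- move=> i; rewrite mem_filter => /andP[hc _] /andP[h4 /existsP[d /and3P[/eqP d1 /eqP d2 /eqP d3]]].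
  rewrite -d1; congr val; congr fst.
  case/skew_sytP: hT => _ _ h _ _; apply: h => //; last by apply: val_inj; rewrite /= d3.
  by apply: corner_mem; rewrite ?d1.
Qed.

Lemma skew_syt_num_iter N k l m : decreasing l -> sumn l <= N -> sumn l = k + m ->
  (forall i, nth 0 l i <= N) -> size l <= N ->
  skew_syt_num N l m = iter k down (fun t => (m <= nth 0 t 0 : nat)) l.
Proof.
elim: k l => [|k IH] t hdec hN0 hsum hN hsz.
  rewrite /= /skew_syt_num; case: ifP => // hm.
  have hD : skew_cells N t m = set0.
    by apply/eqP; rewrite -cards_eq0; move: (card_skew_cells N t m hsz hN hm); lia.
  apply/eqP/cards1P; exists [ffun=> ord0]; apply/setP => T; rewrite !inE.
  apply/skew_sytP/eqP => [[h1 _ _ _ _]|->].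
    by apply/ffunP => c; rewrite ffunE h1 // hD inE.
  by rewrite hD; split=> [c|c|c c'|c c'|c c']; rewrite ?ffunE ?inE.
rewrite skew_syt_num_down //; last by lia.
rewrite iterS /down; apply: eq_bigr => i hc.
have hs := sumn_dec _ _ hc.
apply: IH; [exact: decreasing_dec|lia|lia| |by rewrite size_dec ?corner_size].
by move=> j; rewrite nth_dec; move: (hN j); lia.
Qed.

(** The shapes reached have [m] boxes, so the final test asks whether the shape is the row [(m)]. *)
Lemma f_skew_down l m : decreasing l -> size l <= sumn l -> m <= sumn l ->
  f_skew l m = iter (sumn l - m) down (fun t => (m <= nth 0 t 0 : nat)) l.
Proof.
move=> hdec hsz hm; rewrite f_skewE; apply: skew_syt_num_iter => //; first by lia.
exact: nth_leq_sumn.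
Qed.

(** * Row insertion and its inverse *)

Definition col_lt (r r' : seq nat) : bool :=
  (size r' <= size r) && all (fun j => nth 0 r j < nth 0 r' j) (iota 0 (size r')).

(* Empty rows are allowed, so that a tableau can have a prescribed number of rows. *)
Fixpoint tableau (T : seq (seq nat)) : bool :=
  if T is r :: t then [&& sorted ltn r, col_lt r (head [::] t) & tableau t] else true.

Lemma col_ltP r r' :
  reflect (size r' <= size r /\ forall j, j < size r' -> nth 0 r j < nth 0 r' j) (col_lt r r').
Proof.
apply: (iffP andP) => [[h1 /allP h2]|[h1 h2]]; split=> //.
  by move=> j hj; apply: h2; rewrite mem_iota.
by apply/allP => j; rewrite mem_iota; apply: h2.
Qed.

Lemma sorted_ltnP r :
  reflect (forall i j, i < j -> j < size r -> nth 0 r i < nth 0 r j) (sorted ltn r).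
Proof.
apply: (iffP idP) => [h i j hij hj|h].
  by apply: (sorted_ltn_nth ltn_trans 0 h) => //; rewrite inE; lia.
by apply/(sortedP 0) => i hi; apply: h.
Qed.

Lemma find_eq (T : Type) (x0 : T) (a : pred T) s j : j < size s -> a (nth x0 s j) ->
  (forall q, q < j -> ~~ a (nth x0 s q)) -> find a s = j.
Proof.
move=> hj ha hq; have hs : has a s by apply/(has_nthP x0); exists j.
apply/eqP; rewrite eqn_leq; apply/andP; split.
  by rewrite leqNgt; apply/negP => h; rewrite (before_find x0 h) in ha.
by rewrite leqNgt; apply/negP => /hq; rewrite nth_find.
Qed.

Lemma perm_set_nth (s : seq nat) j x : j < size s ->
  perm_eq (nth 0 s j :: set_nth 0 s j x) (x :: s).
Proof.
move=> hj; rewrite set_nthE hj -{4}(cat_take_drop j s) (drop_nth 0 hj).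
rewrite -[_ :: take j s ++ _]/([:: nth 0 s j] ++ _) -[x :: (_ ++ _)]/([:: x] ++ _).
by apply/permP => a; rewrite /= !count_cat /=; lia.
Qed.

Lemma perm_row_insert T x : perm_eq (flatten (row_insert T x)) (x :: flatten T).
Proof.
elim: T x => [|r t IH] x //=.
case: ifP => h /=; last first.
  by apply/permP => a; rewrite -cats1 /= !count_cat /=; lia.
have hj : find (fun y => x < y) r < size r by rewrite -has_find.
apply/permP => a; move/permP: (perm_set_nth r _ x hj) => /(_ a).
by move/permP: (IH (nth 0 r (find (fun y => x < y) r))) => /(_ a) /=; rewrite !count_cat; lia.
Qed.

(** Reverse bumping from the end of row [i] upwards, returning the smaller tableau and the value
    expelled from the first row. The column [j] is that of the last entry smaller than the value
    coming from below. *)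
Fixpoint unins (T : seq (seq nat)) (i : nat) : seq (seq nat) * nat :=
  match T, i with
  | [::], _ => ([::], 0)
  | r :: t, 0 => (take (size r).-1 r :: t, nth 0 r (size r).-1)
  | r :: t, i'.+1 =>
      let p := unins t i' in
      let j := (find (fun z => p.2 <= z) r).-1 in
      (set_nth 0 r j p.2 :: p.1, nth 0 r j)
  end.

Lemma nth_set (s : seq nat) j x q : nth 0 (set_nth 0 s j x) q = if q == j then x else nth 0 s q.
Proof. by rewrite nth_set_nth. Qed.

Lemma size_set (s : seq nat) j x : j < size s -> size (set_nth 0 s j x) = size s.
Proof. by move=> h; rewrite size_set_nth (maxn_idPr h). Qed.

Lemma set_set (s : seq nat) j x : j < size s -> set_nth 0 (set_nth 0 s j x) j (nth 0 s j) = s.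
Proof.
move=> h; apply: (@eq_from_nth _ 0); first by rewrite !size_set.
by move=> q _; rewrite !nth_set; case: eqP => [->|].
Qed.

Lemma sorted_set r j x : sorted ltn r -> j < size r ->
  (forall q, q < j -> nth 0 r q < x) -> (forall q, j < q -> q < size r -> x < nth 0 r q) ->
  sorted ltn (set_nth 0 r j x).
Proof.
move=> /sorted_ltnP hr hj h1 h2; apply/sorted_ltnP => p q hpq; rewrite size_set // => hq; rewrite !nth_set.
case: (p =P j) => [ep|_]; case: (q =P j) => [eq|_]; try lia.
- by apply: h2 => //; lia.
- by apply: h1; lia.
- exact: hr.
Qed.

Lemma corner_cons a s i : corner (a :: s) i.+1 = corner s i.
Proof. by []. Qed.

Lemma dec_cons a s i : dec (a :: s) i.+1 = a :: dec s i.
Proof. by []. Qed.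

Lemma nth0_map_size (t : seq (seq nat)) : nth 0 (map size t) 0 = size (head [::] t).
Proof. by case: t. Qed.

(** The hypothesis on sizes says that the bumping path ends within the given rows, possibly in an
    empty one. The row [i] is where it ends. *)
Lemma row_insert_tableau T x : tableau T -> uniq (x :: flatten T) ->
  size (row_insert T x) = size T ->
  tableau (row_insert T x) /\
  exists i, [/\ corner (map size (row_insert T x)) i,
                map size T = dec (map size (row_insert T x)) i &
                unins (row_insert T x) i = (T, x)].
Proof.
elim: T x => [|r t IH] x; first by [].
move=> /= /and3P[hr hcol ht] /andP[].
rewrite mem_cat negb_or cat_uniq => /andP[hxr hxt] /and3P[hur hrt hut].
have hxn q : q < size r -> nth 0 r q != x.
  by move=> hq; apply: contraNneq hxr => <-; apply: mem_nth.
case: ifP => hhas; last first.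
  move=> _; have hlt q : q < size r -> nth 0 r q < x.
    move=> hq; rewrite ltn_neqAle hxn //= leqNgt; apply/negP => h.
    by move/negP: hhas; apply; apply/(has_nthP 0); exists q.
  case/col_ltP: hcol => hc1 hc2; split.
    rewrite /= ht andbT; apply/andP; split.
      apply/sorted_ltnP => p q hpq; rewrite size_rcons ltnS leq_eqVlt !nth_rcons => /orP[/eqP eq|hq].
        by rewrite eq ltnn eqxx -eq hpq hlt // -eq.
      by rewrite hq (ltn_trans hpq hq); apply: (sorted_ltnP _ hr).
    apply/col_ltP; rewrite size_rcons; split; first exact: leq_trans hc1 _.
    by move=> q hq; rewrite nth_rcons (leq_trans hq hc1); apply: hc2.
  exists 0; rewrite /corner /dec /= nth0_map_size size_rcons ltnS.
  split=> //; rewrite nth_rcons ltnn eqxx -cats1 take_size_cat //.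
set j := find _ r; set y := nth 0 r j; set r1 := set_nth 0 r j x.
case=> hsz.
have hj : j < size r by rewrite /j -has_find.
have hxy : x < y by apply: (nth_find 0 hhas).
have hlt q : q < j -> nth 0 r q < x.
  move=> hq; rewrite ltn_neqAle hxn ?(ltn_trans hq) //= leqNgt.
  by have := before_find 0 hq => /= ->.
have hgt q : j < q -> q < size r -> y < nth 0 r q by apply: (sorted_ltnP _ hr).
have hu : uniq (y :: flatten t).
  rewrite /= hut andbT; apply/negP => hy; move/negP: hrt; apply.
  by apply/hasP; exists y => //; apply: mem_nth.
have [ht1 [i [h1 h2 h3]]] := IH y ht hu hsz.
split.
  rewrite /= ht1 andbT sorted_set //=; last first.
    by move=> q hq hq'; apply: ltn_trans hxy (hgt q hq hq').
  case: t hcol {IH ht hxt hrt hut hu ht1 h1 h2 h3} hsz => [|r' t] // /col_ltP[/= hc1 hc2] _.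
  (* Bumping paths move weakly left: the entry below column [j], if any, exceeds [y], so [y] lands
     in a column at most [j], where the new row [r1] is smaller than [y]. *)
  have hr1 q : q < size r -> q <= j -> nth 0 r1 q < y.
    move=> hq hqj; rewrite nth_set; case: (q =P j) => // hne.
    by apply: (sorted_ltnP _ hr) => //; lia.
  have hr1r q : nth 0 r1 q <= nth 0 r q.
    by rewrite nth_set; case: (q =P j) => // ->; apply: ltnW.
  have hs1 : size r1 = size r by rewrite size_set.
  case: ifP => hh /=; apply/col_ltP; rewrite hs1.
    have hj' : find (fun z => y < z) r' < size r' by rewrite -has_find.
    rewrite size_set //; split=> // q hq; rewrite [X in _ < X]nth_set.
    case: (q =P _) => [->|_]; last by apply: leq_ltn_trans (hr1r q) (hc2 q hq).
    apply: hr1; first by apply: leq_trans hj' hc1.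
    rewrite leqNgt; apply/negP => hlt'.
    have := before_find 0 hlt' => /=; rewrite hc2 //; exact: ltn_trans hlt' hj'.
  have hle : size r' <= j.
    rewrite leqNgt; apply/negP => hlt'; move/negP: hh; apply.
    by apply/(has_nthP 0); exists j => //; apply: hc2.
  rewrite size_rcons; split; first exact: leq_ltn_trans hle hj.
  move=> q; rewrite ltnS leq_eqVlt nth_rcons => /orP[/eqP ->|hq].
    by rewrite ltnn eqxx; apply: hr1 => //; apply: leq_ltn_trans hle hj.
  by rewrite hq; apply: leq_ltn_trans (hr1r q) (hc2 q hq).
exists i.+1; rewrite /= corner_cons dec_cons size_set // h2; split=> //.
rewrite h3 /=.
(* Reverse bumping finds the same column again: [x], now in column [j], is below [y], and everything
   to its right is above [y]. *)
have -> : find (fun z => y <= z) r1 = j.+1.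
  case: (ltnP j.+1 (size r)) => hj1.
    apply: (find_eq _ 0); rewrite ?size_set //.
      by rewrite nth_set gtn_eqF // ltnW // hgt.
    move=> q; rewrite ltnS leq_eqVlt nth_set => /orP[/eqP ->|hq]; first by rewrite eqxx -ltnNge.
    by rewrite ltn_eqF // -ltnNge; apply: ltn_trans (hlt q hq) hxy.
  have -> : j.+1 = size r1 by rewrite size_set //; lia.
  apply: hasNfind; apply/negP => /(has_nthP 0)[q]; rewrite size_set // nth_set => hq.
  case: (q =P j) => [_|hne]; rewrite leqNgt; first by rewrite hxy.
  by rewrite (ltn_trans (hlt q _) hxy) //; lia.
by rewrite /= set_set // nth_set eqxx.
Qed.

(** The existential clause strengthens the induction: the first row changes only in the column [j]
    of the expelled value, where the entry grows or disappears. Strictness of the columns against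
    the row above needs exactly this. *)
Lemma unins_tableau T i : tableau T -> uniq (flatten T) -> corner (map size T) i ->
  let p := unins T i in
  [/\ tableau p.1, map size p.1 = dec (map size T) i, row_insert p.1 p.2 = T &
      exists j, [/\ j < size (head [::] T), p.2 = nth 0 (head [::] T) j,
        size (head [::] p.1) <= size (head [::] T) &
        forall q, q < size (head [::] p.1) ->
          if q == j then is_true (p.2 < nth 0 (head [::] p.1) q)
          else nth 0 (head [::] p.1) q = nth 0 (head [::] T) q]].
Proof.
elim: T i => [|r t IH] [|i]; rewrite ?corner_cons /= /corner; try by rewrite ?nth_nil.
  rewrite /= nth0_map_size => /and3P[hr /col_ltP[hc1 hc2] ht] _ hlt.
  have hs : size (take (size r).-1 r) = (size r).-1 by rewrite size_take; case: ifP => //; lia.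
  have hlast : (size r).-1 < size r by lia.
  have hrE : r = rcons (take (size r).-1 r) (nth 0 r (size r).-1).
    by rewrite -take_nth // prednK ?take_size //; lia.
  split.
  - rewrite ht andbT; apply/andP; split; first exact: take_sorted.
    apply/col_ltP; rewrite hs; split; first by lia.
    by move=> q hq; rewrite nth_take; [apply: hc2|lia].
  - by rewrite hs /dec.
  - rewrite ifF -?hrE //; apply/negP => /(has_nthP 0)[q]; rewrite hs => hq.
    rewrite nth_take // => h; have := sorted_ltnP _ hr _ _ hq hlast.
    by rewrite ltnNge ltnW.
  - exists (size r).-1; rewrite hs; split=> //; first by lia.
    by move=> q hq; rewrite ltn_eqF // nth_take.
move=> /and3P[hr /col_ltP[hc1 hc2] ht]; rewrite cat_uniq => /and3P[hur hrt hut] hc.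
have [h1 h2 h3 [j' [g1 g2 g3 g4]]] := IH i ht hut hc.
move: h1 h2 h3 g2 g3 g4; set p := unins t i; set y := p.2 => h1 h2 h3 g2 g3 g4.
have hst : sorted ltn (head [::] t) by case: (t) ht => //= r' t' /and3P[].
have hyt : y \in flatten t.
  by rewrite -h3 (perm_mem (perm_row_insert _ _)) inE eqxx.
have hyr q : q < size r -> nth 0 r q != y.
  move=> hq; apply/eqP => e; move/negP: hrt; apply.
  by apply/hasP; exists y => //; rewrite -e; apply: mem_nth.
have hj'r : j' < size r by apply: leq_trans g1 hc1.
set k := find (fun z => y <= z) r.
(* Reverse paths move weakly right: by column strictness the entries of [r] up to column [j'] are
   below [y]. *)
have hk : j' < k.
  rewrite ltnNge; apply/negP => hle.
  have hkr : k < size r by apply: leq_ltn_trans hle hj'r.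
  have := nth_find 0 (a := fun z => y <= z) (s := r); rewrite has_find -/k hkr => /(_ isT).
  rewrite leqNgt (_ : nth 0 r k < y) // g2; apply: leq_ltn_trans (hc2 j' g1).
  by move: hle; rewrite leq_eqVlt => /orP[/eqP ->|h] //; apply: ltnW (sorted_ltnP _ hr _ _ h _).
have hkr : k <= size r by apply: find_size.
have ekj : k = k.-1.+1 by lia.
set j := k.-1 in ekj *.
have hj : j < size r by lia.
have hxy : nth 0 r j < y by have := before_find 0 (a := fun z => y <= z) (s := r) (i := j); rewrite -/k ekj ltnSn ltnNge => /(_ isT) ->.
have hgt q : j < q -> q < size r -> y < nth 0 r q.
  move=> hq hqr; rewrite ltn_neqAle eq_sym hyr //=.
  have hh : has (fun z => y <= z) r by rewrite has_find -/k ekj; apply: leq_ltn_trans hq hqr.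
  have := nth_find 0 hh; rewrite /= -/k => hyk.
  have : k <= q by rewrite ekj.
  rewrite leq_eqVlt => /orP[/eqP <-|h] //.
  by apply: leq_trans hyk (ltnW (sorted_ltnP _ hr _ _ h hqr)).
have hltj q : q < j -> nth 0 r q < nth 0 r j by move=> hq; apply: (sorted_ltnP _ hr).
split.
- rewrite h1 andbT; apply/andP; split.
    by apply: sorted_set => // q hq; apply: ltn_trans (hltj q hq) hxy.
  apply/col_ltP; rewrite size_set //; split; first exact: leq_trans g3 hc1.
  move=> q hq; have hq0 : q < size (head [::] t) by apply: leq_trans hq g3.
  move: (g4 q hq) (hc2 q hq0); rewrite nth_set.
  case: (q =P j') => [eq|nq]; case: (q =P j) => [eqj|nqj] //.
  + by rewrite g2 -eq => ? ?; lia.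
  + by move=> -> _; rewrite g2; apply: (sorted_ltnP _ hst) => //; lia.
  + by move=> -> .
- by rewrite size_set // h2.
- rewrite (_ : find _ (set_nth 0 r j y) = j).
    rewrite set_set // nth_set eqxx h3 ifT //.
    by apply/(has_nthP 0); exists j; rewrite ?size_set // nth_set eqxx.
  apply: (find_eq _ 0); rewrite ?size_set //; first by rewrite nth_set eqxx.
  by move=> q hq; rewrite nth_set ltn_eqF // -leqNgt ltnW // hltj.
- exists j; rewrite size_set //; split=> // q hq.
  by rewrite nth_set; case: (q =P j).
Qed.

(** * Words with a given insertion tableau *)

Definition padded_rsk (N : nat) (w : seq nat) : seq (seq nat) := foldl row_insert (nseq N [::]) w.

Lemma padded_rsk_rcons N w x : padded_rsk N (rcons w x) = row_insert (padded_rsk N w) x.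
Proof. by rewrite /padded_rsk foldl_rcons. Qed.

Lemma size_row_insert T x : size T <= size (row_insert T x).
Proof. by elim: T x => [|r t IH] x //=; case: ifP => //= _; apply: IH. Qed.

Lemma size_padded_rsk N w : N <= size (padded_rsk N w).
Proof.
elim/last_ind: w => [|w x IH]; first by rewrite size_nseq.
by rewrite padded_rsk_rcons; apply: leq_trans IH (size_row_insert _ _).
Qed.

Lemma flatten_nseq_nil (T : Type) N : flatten (nseq N [::]) = [::] :> seq T.
Proof. by elim: N. Qed.

Lemma perm_padded_rsk N w : perm_eq (flatten (padded_rsk N w)) w.
Proof.
elim/last_ind: w => [|w x IH]; first by rewrite flatten_nseq_nil.
rewrite padded_rsk_rcons; apply: perm_trans (perm_row_insert _ _) _.
by rewrite perm_sym perm_rcons perm_cons perm_sym.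
Qed.

Lemma tableau_padded_rsk N w : uniq w -> size (padded_rsk N w) = N -> tableau (padded_rsk N w).
Proof.
elim/last_ind: w => [|w x IH] hu hs.
  by rewrite /padded_rsk /=; elim: N {hs} => //= N ->; case: N.
move: hu hs; rewrite padded_rsk_rcons rcons_uniq => /andP[hx hw] hs.
have hN : size (padded_rsk N w) = N.
  by have := size_padded_rsk N w; have := size_row_insert (padded_rsk N w) x; lia.
apply: (proj1 (row_insert_tableau _ x (IH hw hN) _ _)); last by rewrite hN.
by rewrite /= (perm_mem (perm_padded_rsk N w)) hx (perm_uniq (perm_padded_rsk N w)).
Qed.

Lemma dec_inj s i j : corner s i -> corner s j -> dec s i = dec s j -> i = j.
Proof.
rewrite /corner => hi hj e; have := congr1 (fun t => nth 0 t i) e.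
by rewrite !nth_dec eqxx; case: (i =P j) => // _; lia.
Qed.

(** The successive choices of [i] play the role of the recording tableau. *)
Fixpoint rsk_words (k : nat) (T : seq (seq nat)) : seq (seq nat) :=
  if k is k'.+1 then
    flatten [seq [seq rcons w (unins T i).2 | w <- rsk_words k' (unins T i).1]
            | i <- iota 0 (size T) & corner (map size T) i]
  else [:: [::]].

Lemma unins_flatten T i k : tableau T -> uniq (flatten T) -> corner (map size T) i ->
  size (flatten T) = k.+1 ->
  [/\ tableau (unins T i).1, uniq (flatten (unins T i).1), size (flatten (unins T i).1) = k &
      size (unins T i).1 = size T].
Proof.
move=> hT hu hc hk; have [h1 h2 h3 _] := unins_tableau T i hT hu hc.
have hp := perm_row_insert (unins T i).1 (unins T i).2; rewrite h3 in hp.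
split=> //.
- by move: hu; rewrite (perm_uniq hp) /= => /andP[].
- by move: hk; rewrite (perm_size hp) /= => -[].
- by have := congr1 size h2; rewrite size_map size_dec ?size_map // -(size_map size) corner_size.
Qed.

(** The last insertion ended in a row that [unins] can start from to recover the last letter and the
    tableau of the prefix. No other row does so, since the corner is determined by the shape of that
    tableau. *)
Lemma count_rsk_words k T w : tableau T -> uniq (flatten T) -> size (flatten T) = k ->
  count_mem w (rsk_words k T) = (padded_rsk (size T) w == T).
Proof.
elim: k T w => [|k IH] T w hT hu hk.
  rewrite /= addn0; congr nat_of_bool; apply/eqP/eqP => [<-|e].
    rewrite /padded_rsk /=; elim: T {hT hu} hk => //= -[|x r] t IH //= hk.
    by rewrite IH.
  by apply/esym/size0nil; rewrite -(perm_size (perm_padded_rsk (size T) w)) e.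
rewrite /= count_flatten_map big_filter.
case/lastP: w => [|w x].
  rewrite big1 => [|i _].
    apply/esym/eqP; rewrite eqb0; apply/eqP => e; move: hk.
    by rewrite -e (perm_size (perm_padded_rsk _ _)).
  by rewrite count_map; apply/eqP; rewrite -leqn0 leqNgt -has_count; apply/hasPn => -[].
rewrite padded_rsk_rcons.
transitivity (\sum_(i <- [seq i <- iota 0 (size T) | corner (map size T) i])
    (unins T i == (padded_rsk (size T) w, x) : nat)).
  rewrite big_filter; apply: eq_bigr => i hc.
  have [h1 h2 h3 h4] := unins_flatten T i k hT hu hc hk.
  rewrite count_map (eq_count (a2 := fun v => (v == w) && ((unins T i).2 == x))); last first.
    by move=> v; rewrite /= eqseq_rcons.
  move: h1 h2 h3 h4; case: (unins T i) => T' y /= h1 h2 h3 h4.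
  rewrite xpair_eqE; case: (y == x); rewrite ?andbT ?andbF.
    by rewrite (eq_count (a2 := pred1 w)) => [|v]; rewrite ?andbT // IH // h4 eq_sym.
  by rewrite (eq_count (a2 := pred0)) ?count_pred0 // => v; rewrite andbF.
case: eqP => [e|ne]; last first.
  apply: big1_seq => i; rewrite mem_filter => /and3P[_ hc _]; apply/eqP; rewrite eqb0.
  apply/eqP => e; have [_ _ h _] := unins_tableau T i hT hu hc.
  by apply: ne; rewrite -[RHS]h e.
have hp : perm_eq (flatten T) (rcons w x).
  by rewrite -e -padded_rsk_rcons perm_padded_rsk.
have hs : size (padded_rsk (size T) w) = size T.
  have := size_padded_rsk (size T) w; have := size_row_insert (padded_rsk (size T) w) x.
  by rewrite e; lia.
have := hu; rewrite (perm_uniq hp) rcons_uniq => /andP[hx hw].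
have hT0 := tableau_padded_rsk _ _ hw hs.
have hu0 : uniq (x :: flatten (padded_rsk (size T) w)).
  by rewrite /= (perm_mem (perm_padded_rsk _ w)) hx (perm_uniq (perm_padded_rsk _ w)).
have [|_ [i]] := row_insert_tableau _ x hT0 hu0; first by rewrite e hs.
rewrite e => -[h1 h2 h3]; apply: (sum_nat_uniq_true _ _ _ i).
- by rewrite filter_uniq ?iota_uniq.
- by rewrite mem_filter h1 mem_iota -(size_map size) corner_size.
- by rewrite h3.
- move=> j; rewrite mem_filter => /andP[hc _] /eqP ej; apply: (dec_inj _ _ _ hc h1).
  by have [_ <- _ _] := unins_tableau T j hT hu hc; rewrite ej.
Qed.

Lemma size_flatten_map (T S : Type) (F : T -> seq S) (s : seq T) :
  size (flatten [seq F i | i <- s]) = \sum_(i <- s) size (F i).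
Proof. by elim: s => [|x s IH]; rewrite ?big_nil ?big_cons //= size_cat IH. Qed.

Lemma size_rsk_words k T : tableau T -> uniq (flatten T) -> size (flatten T) = k ->
  size (rsk_words k T) = iter k down (fun=> 1) (map size T).
Proof.
elim: k T => [//|k IH] T hT hu hk.
rewrite iterS /= size_flatten_map big_filter /down size_map /index_iota subn0.
apply: eq_bigr => i hc; rewrite size_map.
have [h1 h2 h3 h4] := unins_flatten T i k hT hu hc hk.
by rewrite IH //; have [_ -> _ _] := unins_tableau T i hT hu hc.
Qed.

(** * Words whose large letters increase *)

Definition reading (T : seq (seq nat)) : seq nat := flatten (rev T).

Definition increasing_above (a : nat) (w : seq nat) : bool := sorted ltn [seq x <- w | a < x].

Lemma reading_cons r t : reading (r :: t) = reading t ++ r.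
Proof. by rewrite /reading rev_cons flatten_rcons. Qed.

Lemma increasing_aboveF a x y u v w : a < x -> x < y ->
  increasing_above a (u ++ y :: v ++ x :: w) = false.
Proof.
move=> hax hxy; apply/negP => h.
have : sorted ltn [:: y; x].
  apply: (subseq_sorted ltn_trans _ h).
  rewrite subseq_filter /= (ltn_trans hax hxy) hax /=.
  apply: subseq_trans (suffix_subseq _ _) => /=; rewrite eqxx.
  by rewrite sub1seq mem_cat inE eqxx orbT.
by rewrite /= andbT ltnNge ltnW.
Qed.

(** Let [x] bump [y] in the first row. If [a < x], then [y] precedes the smaller [x] in both words,
    and both sides are false. Otherwise the letters that [y] jumps over are at most [x], hence at
    most [a], and the filtered word does not change. *)
Lemma increasing_above_row_insert a T x w :
  increasing_above a (reading (row_insert T x) ++ w) = increasing_above a (reading T ++ x :: w).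
Proof.
elim: T x w => [|r t IH] x w //=.
case: ifP => h; last by rewrite !reading_cons -cats1 -!catA.
rewrite !reading_cons -!catA IH.
set j := find _ r.
have hj : j < size r by rewrite /j -has_find.
have hxy : x < nth 0 r j by apply: (nth_find 0 h).
rewrite set_nthE hj -[in RHS](cat_take_drop j r) (drop_nth 0 hj).
case: (ltnP a x) => hax.
  by rewrite -!catA /= increasing_aboveF // catA increasing_aboveF.
have htake : [seq z <- take j r | a < z] = [::].
  apply/eqP; rewrite -[_ == _]negbK -has_filter; apply/hasPn => z /(nthP 0)[q].
  rewrite size_take hj => hq <-; rewrite nth_take //.
  by have := before_find 0 hq => /= /negbT; lia.
rewrite /increasing_above -!catA !filter_cat /= !filter_cat /= !htake.
by rewrite [a < x]ltnNge hax /= filter_cat; case: (a < _).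
Qed.

Lemma increasing_above_rsk a N w :
  increasing_above a (reading (padded_rsk N w)) = increasing_above a w.
Proof.
rewrite -[reading _]cats0 -[w in RHS]cats0; move: [::] => v.
elim/last_ind: w v => [|w x IH] v.
  by rewrite /padded_rsk /= /reading rev_nseq flatten_nseq_nil.
by rewrite padded_rsk_rcons increasing_above_row_insert IH cat_rcons.
Qed.

(** * Standard tableaux built by adding the largest entry *)

Definition add_box (T : seq (seq nat)) (i x : nat) : seq (seq nat) :=
  set_nth [::] T i (rcons (nth [::] T i) x).
Definition del_box (T : seq (seq nat)) (i : nat) : seq (seq nat) :=
  set_nth [::] T i (take (size (nth [::] T i)).-1 (nth [::] T i)).

Fixpoint std_tableaux (k : nat) (s : seq nat) : seq (seq (seq nat)) :=
  if k is k'.+1 then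
    flatten [seq [seq add_box T i k | T <- std_tableaux k' (dec s i)]
            | i <- iota 0 (size s) & corner s i]
  else [:: nseq (size s) [::]].

Lemma tableauP T :
  reflect (forall i, sorted ltn (nth [::] T i) /\ col_lt (nth [::] T i) (nth [::] T i.+1))
          (tableau T).
Proof.
elim: T => [|r t IH] /=; first by apply: ReflectT => i; rewrite !nth_nil.
apply: (iffP and3P) => [[h1 h2 /IH h3] [|i] /=|h]; first by rewrite nth0.
  exact: h3.
have [h1 h2] := h 0; split=> //.
by apply/IH => i; apply: h i.+1.
Qed.

Lemma size_add_box T i x : i < size T -> size (add_box T i x) = size T.
Proof. by move=> h; rewrite size_set_nth (maxn_idPr h). Qed.

Lemma size_del_box T i : i < size T -> size (del_box T i) = size T.
Proof. by move=> h; rewrite size_set_nth (maxn_idPr h). Qed.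

Lemma nth_add_box T i x q : nth [::] (add_box T i x) q =
  if q == i then rcons (nth [::] T i) x else nth [::] T q.
Proof. by rewrite nth_set_nth. Qed.

Lemma nth_del_box T i q : nth [::] (del_box T i) q =
  if q == i then take (size (nth [::] T i)).-1 (nth [::] T i) else nth [::] T q.
Proof. by rewrite nth_set_nth. Qed.

Definition ends_with (r : seq nat) (x : nat) : bool := r == rcons (take (size r).-1 r) x.

Lemma add_boxE T i x V : i < size V -> size V = size T ->
  (add_box V i x == T) = ends_with (nth [::] T i) x && (V == del_box T i).
Proof.
move=> hi hs; apply/eqP/andP => [<-|[/eqP he /eqP hV]].
  split; first by rewrite /ends_with nth_add_box eqxx size_rcons -{2}cats1 take_size_cat.
  apply/eqP/(@eq_from_nth _ [::]); first by rewrite size_del_box ?size_add_box.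
  move=> q _; rewrite nth_del_box !nth_add_box eqxx; case: (q =P i) => [->|//].
  by rewrite size_rcons -cats1 take_size_cat.
apply: (@eq_from_nth _ [::]); first by rewrite size_add_box.
move=> q _; rewrite nth_add_box hV !nth_del_box eqxx; case: (q =P i) => [->|//].
by rewrite -he.
Qed.

Lemma perm_add_box T i x : i < size T -> perm_eq (flatten (add_box T i x)) (x :: flatten T).
Proof.
elim: T i => [|r t IH] [|i] //=; rewrite /add_box /= => hi.
  by apply/permP => a; rewrite /= !count_cat -cats1 count_cat /=; lia.
apply/permP => a; move/permP: (IH i hi) => /(_ a); rewrite /= !count_cat /add_box /=; lia.
Qed.

Lemma map_size_add_box T i x : i < size T -> map size (add_box T i x) = inc (map size T) i.
Proof.
move=> hi; apply: (@eq_from_nth _ 0).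
  by rewrite size_inc ?size_map ?size_add_box.
move=> q; rewrite size_map size_add_box // => hq.
rewrite nth_inc !(nth_map [::]) ?size_add_box // nth_add_box.
by case: (q =P i) => [->|]; rewrite ?size_rcons; lia.
Qed.

Lemma nth_size_map (T : seq (seq nat)) i : nth 0 (map size T) i = size (nth [::] T i).
Proof.
case: (ltnP i (size T)) => h; first by rewrite (nth_map [::]).
by rewrite !nth_default ?size_map.
Qed.

Lemma mem_nth_flatten (T : seq (seq nat)) i x : x \in nth [::] T i -> x \in flatten T.
Proof.
case: (ltnP i (size T)) => h; last by rewrite nth_default.
by move=> hx; apply/flattenP; exists (nth [::] T i); rewrite ?mem_nth.
Qed.

Lemma tableau_add_box T s i x : decreasing s -> corner s i -> map size T = dec s i ->
  tableau T -> (forall y, y \in flatten T -> y < x) -> tableau (add_box T i x).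
Proof.
move=> hs hc hsz /tableauP hT hx.
have hsize q : size (nth [::] T q) = nth 0 s q - (q == i).
  by rewrite -nth_dec -hsz nth_size_map.
have hlt q j : j < size (nth [::] T q) -> nth 0 (nth [::] T q) j < x.
  by move=> hj; apply/hx/(mem_nth_flatten _ q)/mem_nth.
apply/tableauP => q; rewrite !nth_add_box; split.
  case: (q =P i) => _; last exact: (proj1 (hT q)).
  apply/sorted_ltnP => p r hpr; rewrite size_rcons ltnS leq_eqVlt !nth_rcons => /orP[/eqP er|hr].
    by rewrite er ltnn eqxx -er hpr; apply: hlt; rewrite -er.
  by rewrite hr (ltn_trans hpr hr); apply: (sorted_ltnP _ (proj1 (hT i))).
have [_ /col_ltP[h1 h2]] := hT q; apply/col_ltP.
case: (q =P i) => eq1; case: (q.+1 =P i) => eq2; first by lia.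
- rewrite size_rcons -eq1; split; first by lia.
  by move=> j hj; rewrite nth_rcons (leq_trans hj h1); apply: h2.
- rewrite size_rcons; split.
    by move: (hs q) hc; rewrite !hsize -eq2 eqxx /corner; lia.
  move=> j; rewrite ltnS leq_eqVlt nth_rcons => /orP[/eqP ->|hj].
    rewrite ltnn eqxx; apply: hlt.
    by move: (hs q) hc; rewrite !hsize -eq2 eqxx /corner; lia.
  by rewrite hj -eq2; apply: h2; rewrite eq2.
- by split.
Qed.

Lemma tableau_del_box T i : corner (map size T) i -> tableau T -> tableau (del_box T i).
Proof.
rewrite /corner !nth_size_map => hc /tableauP hT.
apply/tableauP => q; rewrite !nth_del_box; split.
  by case: ifP => _; [apply: take_sorted|]; apply: (proj1 (hT _)).
have [_ /col_ltP[h1 h2]] := hT q; apply/col_ltP.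
have hst : size (take (size (nth [::] T i)).-1 (nth [::] T i)) = (size (nth [::] T i)).-1.
  by rewrite size_take; case: ifP => //; lia.
case: (q =P i) => eq1; case: (q.+1 =P i) => eq2; first by lia.
- rewrite hst eq1; split; first by lia.
  by move=> j hj; rewrite nth_take; [rewrite -eq1; apply: h2; rewrite eq1|lia].
- rewrite hst -eq2; split; first by lia.
  by move=> j hj; rewrite nth_take; [apply: h2; lia|].
- by split.
Qed.

Lemma iota1S k : iota 1 k.+1 = rcons (iota 1 k) k.+1.
Proof. by rewrite -[k.+1 in LHS]addn1 iotaD cats1 add1n. Qed.

(** The entry [k.+1] ends its row at a corner. Its row is the only possible last step, because
    deleting the end of another row would leave [k.+1] behind. *)
Lemma count_std_tableaux k s T : decreasing s -> sumn s = k ->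
  count_mem T (std_tableaux k s) =
  [&& map size T == s, tableau T & perm_eq (flatten T) (iota 1 k)].
Proof.
elim: k s T => [|k IH] s T hs hk.
  have es : s = nseq (size s) 0.
    apply: sumn_nth_eq; rewrite ?size_nseq ?sumn_nseq // => i.
    by rewrite nth_nseq if_same; move: (nth_leq_sumn s i); rewrite hk.
  rewrite /= addn0; congr nat_of_bool; apply/eqP/and3P => [<-|[/eqP h1 _ _]].
    split; first by rewrite map_nseq -es.
      by elim: (size s) => //= N ->; case: N.
    by rewrite flatten_nseq_nil.
  apply: (@eq_from_nth _ [::]); first by rewrite size_nseq -h1 size_map.
  move=> i _; rewrite nth_nseq if_same; apply/esym/size0nil.
  by rewrite -nth_size_map h1 es nth_nseq if_same.
case hsz: (size T == size s); last first.
  rewrite (_ : _ == _ = false) /=; last by apply: contraFF hsz => /eqP <-; rewrite size_map.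
  apply/count_memPn/flattenP => -[L /mapP[i]]; rewrite mem_filter => /andP[hc _] -> /mapP[V].
  rewrite -has_pred1 has_count IH; last first.
  - by move: (sumn_dec _ _ hc); lia.
  - exact: decreasing_dec.
  rewrite lt0b => /and3P[/eqP hV _ _] eT; move: hsz.
  have hVs : size V = size s by rewrite -(size_map size) hV size_dec // corner_size.
  by rewrite eT size_add_box ?hVs ?corner_size // eqxx.
move/eqP: hsz => hsz.
rewrite [std_tableaux _ _]/= count_flatten_map big_filter.
pose good i := ends_with (nth [::] T i) k.+1 &&
  [&& map size (del_box T i) == dec s i, tableau (del_box T i) & perm_eq (flatten (del_box T i)) (iota 1 k)].
transitivity (\sum_(i <- [seq i <- iota 0 (size s) | corner s i]) (good i : nat)).
  rewrite big_filter; apply: eq_bigr => i hc; have hi := corner_size _ _ hc.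
  have IHi V := IH (dec s i) V (decreasing_dec _ _ hs hc) (_ : sumn (dec s i) = k).
  have hsum : sumn (dec s i) = k by move: (sumn_dec _ _ hc); lia.
  rewrite count_map (@eq_in_count _ _ (fun V => ends_with (nth [::] T i) k.+1 && (V == del_box T i))).
    rewrite /good; case: (ends_with _ _) => /=; first by rewrite -IHi.
    by rewrite (@eq_count _ _ pred0) ?count_pred0.
  move=> V; rewrite -has_pred1 has_count IHi // lt0b => /and3P[/eqP hV _ _].
  have hVs : size V = size s by rewrite -(size_map size) hV size_dec // corner_size.
  by rewrite /= add_boxE ?hVs.
have hgood i : corner s i -> good i ->
    [&& map size T == s, tableau T & perm_eq (flatten T) (iota 1 k.+1)] /\ k.+1 \notin flatten (del_box T i).
  move=> hc /andP[he /and3P[/eqP h1 h2 h3]]; have hi := corner_size _ _ hc.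
  have hdi : i < size (del_box T i) by rewrite size_del_box hsz.
  have eT : T = add_box (del_box T i) i k.+1.
    by apply/esym/eqP; rewrite add_boxE ?size_del_box ?hsz // he eqxx.
  have hmem y : y \in flatten (del_box T i) -> y < k.+1.
    by rewrite (perm_mem h3) mem_iota; lia.
  split; last by apply/negP => /hmem; rewrite ltnn.
  rewrite eT map_size_add_box // h1 decK ?eqxx; last by move: hc; rewrite /corner; lia.
  rewrite (tableau_add_box _ s) // !andTb; apply: perm_trans (perm_add_box _ _ _ hdi) _.
  by rewrite iota1S perm_sym perm_rcons perm_cons perm_sym.
case E: [&& _, _ & _]; last first.
  apply: big1_seq => i; rewrite mem_filter => /and3P[_ hc _]; apply/eqP; rewrite eqb0.
  by apply/negP => /(hgood i hc)[]; rewrite E.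
case/and3P: E => /eqP h1 h2 h3.
have hle y : y \in flatten T -> y <= k.+1 by rewrite (perm_mem h3) mem_iota; lia.
have hlen i j : j < size (nth [::] T i) -> nth 0 (nth [::] T i) j <= k.+1.
  by move=> hj; apply/hle/(mem_nth_flatten _ i)/mem_nth.
have : k.+1 \in flatten T by rewrite (perm_mem h3) mem_iota; lia.
case/flattenP => r /(nthP [::])[i hi <-] /(nthP 0)[j hj ej].
have [/sorted_ltnP hr /col_ltP[hc1 hc2]] := tableauP _ h2 i.
have ejs : j.+1 = size (nth [::] T i).
  apply/eqP; rewrite eqn_leq hj leqNgt; apply/negP => h.
  by have := hr _ _ (ltnSn j) h; rewrite ej ltnNge hlen.
have hc : corner s i.
  rewrite /corner -h1 !nth_size_map -ejs ltnS leqNgt; apply/negP => h.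
  by have := hc2 j h; rewrite ej ltnNge hlen.
have he : ends_with (nth [::] T i) k.+1.
  by apply/eqP; rewrite -ejs /= -ej -take_nth // ejs take_size.
have hdi : i < size (del_box T i) by rewrite size_del_box.
have eT : T = add_box (del_box T i) i k.+1.
  by apply/esym/eqP; rewrite add_boxE ?size_del_box // he eqxx.
have hgi : good i.
  rewrite /good he tableau_del_box ?h1 //=; apply/andP; split.
    apply/eqP; rewrite -h1 {2}eT map_size_add_box // incK //.
    by rewrite size_map.
  have := perm_add_box _ _ k.+1 hdi; rewrite -eT perm_sym => h.
  by have := perm_trans h h3; rewrite iota1S perm_sym perm_rcons perm_cons perm_sym.
apply: (sum_nat_uniq_true _ _ _ i) => //.
- by rewrite filter_uniq ?iota_uniq.
- by rewrite mem_filter hc mem_iota -hsz.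
- move=> i'; rewrite mem_filter => /andP[hc' _] hgi'.
  apply/eqP; apply: contraT => hne; have [_ /negP[]] := hgood i' hc' hgi'.
  apply: (mem_nth_flatten _ i); rewrite nth_del_box eq_sym (negbTE hne).
  by rewrite -ej mem_nth.
Qed.

Lemma sorted_insert_max (u v : seq nat) n : (forall y, y \in u ++ v -> y < n) ->
  sorted ltn (u ++ n :: v) = sorted ltn (u ++ v) && nilp v.
Proof.
move=> h; rewrite !(sorted_pairwise ltn_trans) !pairwise_cat /=.
case: v h => [|y v] h.
  rewrite cats0 in h; rewrite /= !andbT !allrel0r /=.
  by rewrite (_ : allrel _ _ _) //; apply/allrelP => x z hx; rewrite inE => /eqP ->; apply: h.
by rewrite /= [n < y]ltnNge ltnW ?h ?mem_cat ?inE ?eqxx ?orbT //= !andbF.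
Qed.

(* The condition under which a new maximum can be added to row [b] with the
   entries above [a] remaining in order in the reading word. *)
Definition strip_above (a b : nat) (T : seq (seq nat)) : bool :=
  increasing_above a (reading T) && all (leq^~ a) (flatten (take b T)).

Lemma add_box_split T i x : i < size T ->
  add_box T i x = take i T ++ rcons (nth [::] T i) x :: drop i.+1 T.
Proof. by move=> h; rewrite /add_box set_nthE h. Qed.

Lemma reading_cat s t : reading (s ++ t) = reading t ++ reading s.
Proof. by rewrite /reading rev_cat flatten_cat. Qed.

Lemma perm_reading T : perm_eq (reading T) (flatten T).
Proof. by apply: perm_flatten; rewrite perm_rev. Qed.

(** In the reading word the rows above row [i] come after [n], so the maximum [n] is in order
    exactly when those rows have no entry above [a]. As [n] itself exceeds [a], it must avoid the
    first [b] rows. *)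
Lemma strip_above_add_box a b i n T : i < size T -> a < n ->
  (forall y, y \in flatten T -> y < n) ->
  strip_above a b (add_box T i n) = (b <= i) && strip_above a i T.
Proof.
move=> hi han hT; rewrite /strip_above.
set lo := flatten (take i T); set r := nth [::] T i; set hg := reading (drop i.+1 T).
have eT : T = take i T ++ r :: drop i.+1 T by rewrite -drop_nth // cat_take_drop.
have e1 : reading (add_box T i n) = hg ++ r ++ n :: reading (take i T).
  by rewrite add_box_split // reading_cat reading_cons -catA cat_rcons.
have e2 : reading T = hg ++ r ++ reading (take i T).
  by rewrite {1}eT reading_cat reading_cons -catA.
have -> : increasing_above a (reading (add_box T i n)) =
    increasing_above a (reading T) && all (leq^~ a) lo.
  rewrite e1 e2 /increasing_above !filter_cat /= han catA sorted_insert_max; last first.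
    move=> y; rewrite -!filter_cat mem_filter => /andP[_]; rewrite -catA -e2.
    by rewrite (perm_mem (perm_reading T)); apply: hT.
  rewrite -catA; congr andb.
  rewrite /nilp size_filter -leqn0 leqNgt -has_count -all_predC.
  rewrite (eq_all (a2 := leq^~ a)) => [|y]; last by rewrite /= -leqNgt.
  by apply: perm_all; apply: perm_reading.
case: (leqP b i) => hbi; last first.
  rewrite (_ : all _ (flatten (take b _)) = false) ?andbF //.
  apply/negP => /allP /(_ n); rewrite leqNgt han => h.
  suff /h : n \in flatten (take b (add_box T i n)) by [].
  apply/flattenP; exists (rcons r n); last by rewrite mem_rcons inE eqxx.
  rewrite add_box_split // take_cat size_take hi ltnNge (ltnW hbi) /= mem_cat.
  by rewrite orbC; case: (b - i) (subn_gt0 i b) => [|d]; rewrite ?hbi //= inE eqxx.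
have -> : flatten (take b (add_box T i n)) = flatten (take b T).
  rewrite add_box_split // [in RHS]eT !take_cat size_take hi.
  case: (ltnP b i) => // hib; have -> : b = i by lia.
  by rewrite subnn.
rewrite -andbA; case: (increasing_above _ _) => //=.
apply: andb_idr => /allP h; apply/allP => x hx; apply: h.
rewrite /lo -(subnKC hbi) takeD flatten_cat mem_cat.
by rewrite hx.
Qed.

Lemma mem_std_tableaux k s T : decreasing s -> sumn s = k -> T \in std_tableaux k s ->
  [/\ map size T = s, tableau T & perm_eq (flatten T) (iota 1 k)].
Proof.
move=> hs hk; rewrite -has_pred1 has_count count_std_tableaux // lt0b.
by move=> /and3P[/eqP].
Qed.

Lemma size_std_tableaux k s : size (std_tableaux k s) = iter k down (fun=> 1) s.
Proof.
elim: k s => [//|k IH] s.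
rewrite iterS /= size_flatten_map big_filter /down /index_iota subn0.
by apply: eq_bigr => i _; rewrite size_map IH.
Qed.

Lemma big_iota_geq N b (P : pred nat) (F : nat -> nat) :
  \sum_(i <- iota b (N - b) | P i) F i = \sum_(i <- iota 0 N | P i) (b <= i) * F i.
Proof.
case: (leqP b N) => h.
  have -> : iota 0 N = iota 0 b ++ iota b (N - b) by rewrite -iotaD subnKC.
  rewrite big_cat /= [X in _ = X + _]big1_seq ?add0n => [|i /andP[_]].
    rewrite [LHS]big_seq_cond [RHS]big_seq_cond; apply: eq_bigr => i /andP[].
    by rewrite mem_iota => /andP[-> _] _; rewrite mul1n.
  by rewrite mem_iota => hi; rewrite leqNgt (_ : i < b).
rewrite (_ : N - b = 0) ?big_nil; last by lia.
apply/esym/big1_seq => i /andP[_]; rewrite mem_iota => hi.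
by rewrite leqNgt (_ : i < b) //; lia.
Qed.

(** Deleting the entries above [a] from the largest down visits weakly increasing rows, which is the
    recursion of [hstrips]; a standard tableau with [a] entries remains. *)
Lemma count_strip_above a b m s : decreasing s -> sumn s = a + m ->
  count (strip_above a b) (std_tableaux (a + m) s) =
  \sum_(t <- hstrips m b s) iter a down (fun=> 1) t.
Proof.
elim: m b s => [|m IH] b s hs hk.
  rewrite addn0 in hk *; rewrite big_seq1 -size_std_tableaux.
  apply/eqP; rewrite -all_count; apply/allP => T hT.
  have [_ _ hp] := mem_std_tableaux _ _ _ hs hk hT.
  have hle : all (leq^~ a) (flatten T).
    by apply/allP => x; rewrite (perm_mem hp) mem_iota; lia.
  apply/andP; split.
    rewrite /increasing_above (_ : filter _ _ = [::]) //; apply/eqP.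
    rewrite -[_ == _]negbK -has_filter; apply/hasPn => x.
    by rewrite (perm_mem (perm_reading T)) => /(allP hle); rewrite -leqNgt.
  apply/allP => x hx; apply: (allP hle).
  by rewrite -(cat_take_drop b T) flatten_cat mem_cat hx.
rewrite addnS [std_tableaux _ _]/= [hstrips _ _ _]/= count_flatten_map big_filter.
rewrite big_flatten big_map big_filter big_iota_geq; apply: eq_bigr => i hc.
have hi := corner_size _ _ hc.
have hs' := decreasing_dec _ _ hs hc.
have hk' : sumn (dec s i) = a + m by move: (sumn_dec _ _ hc); lia.
rewrite -IH // count_map.
rewrite (@eq_in_count _ _ (fun T => (b <= i) && strip_above a i T)).
  case: (b <= i) => /=; rewrite ?mul1n ?mul0n //.
  by rewrite (@eq_count _ _ pred0) ?count_pred0.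
move=> T hT; have [h1 _ hp] := mem_std_tableaux _ _ _ hs' hk' hT.
rewrite /= strip_above_add_box //.
- by rewrite -(size_map size) h1 size_dec.
- by lia.
- by move=> y; rewrite (perm_mem hp) mem_iota; lia.
Qed.

(** Words are grouped by insertion tableau. The condition depends on that tableau only, and the size
    of each group depends on its shape only, which gives the product. *)
Lemma count_increasing_shape n a l : decreasing l -> sumn l = n -> a <= n ->
  count (fun w => increasing_above a w && (map size (padded_rsk (size l) w) == l))
        (permutations (iota 1 n)) =
  iter n down (fun=> 1) l * \sum_(t <- hstrips (n - a) 0 l) iter a down (fun=> 1) t.
Proof.
move=> hl hn ha; pose L := [seq T <- std_tableaux n l | increasing_above a (reading T)].
have hL T : T \in L -> [/\ map size T = l, tableau T & perm_eq (flatten T) (iota 1 n)].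
  by rewrite mem_filter => /andP[_]; apply: mem_std_tableaux.
have hu T : T \in L -> uniq (flatten T) /\ size (flatten T) = n.
  by case/hL => _ _ h; rewrite (perm_uniq h) (perm_size h) iota_uniq size_iota.
transitivity (size (flatten [seq rsk_words n T | T <- L])).
  rewrite -size_filter; apply: perm_size; apply/allP => w _; apply/eqP.
  rewrite count_flatten_map.
  have -> : \sum_(T <- L) count_mem w (rsk_words n T) = count_mem (padded_rsk (size l) w) L.
    rewrite -sum1_count [RHS]big_mkcond; apply: eq_big_seq => T hT.
    have [h1 h2 h3] := hL T hT; have [h4 h5] := hu T hT.
    by rewrite count_rsk_words // -[size T](size_map size) h1 /= eq_sym; case: (_ == _).
  rewrite !count_filter.
  rewrite (@eq_count _ _ (fun v => (v == w) && (increasing_above a w && (map size (padded_rsk (size l) w) == l)))); last first.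
    by move=> v /=; case: (v =P w) => [->|].
  rewrite [in RHS](@eq_count _ _ (fun T => (T == padded_rsk (size l) w) && increasing_above a w)); last first.
    by move=> T /=; case: (T =P _) => [->|] //; rewrite increasing_above_rsk.
  case: (increasing_above a w); last first.
    by rewrite !(@eq_count _ _ pred0) ?count_pred0 // => v; rewrite /= !andbF.
  rewrite [in RHS](@eq_count _ _ (pred1 (padded_rsk (size l) w))) => [|T]; last by rewrite /= andbT.
  rewrite count_std_tableaux // (permPl (perm_padded_rsk _ w)).
  case: eqP => E; last first.
    by rewrite (@eq_count _ _ pred0) ?count_pred0 // => v; rewrite /= andbF.
  rewrite (@eq_count _ _ (pred1 w)) => [|v]; last by rewrite /= andbT.
  rewrite count_uniq_mem ?permutations_uniq // mem_permutations /=.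
  case hp: (perm_eq w _); rewrite ?andbF // tableau_padded_rsk //.
    by rewrite (perm_uniq hp) iota_uniq.
  by rewrite -(size_map size) E.
rewrite size_flatten_map (eq_big_seq (fun=> iter n down (fun=> 1) l)); last first.
  move=> T hT; have [h1 h2 h3] := hL T hT; have [h4 h5] := hu T hT.
  by rewrite size_rsk_words // h1.
rewrite big_const_seq count_predT iter_addn_0 size_filter.
rewrite (@eq_count _ _ (strip_above a 0)) => [|T]; last by rewrite /strip_above take0 andbT.
by rewrite -count_strip_above ?subnKC.
Qed.

(** * Top to random shuffles *)

Definition pad (N : nat) (t : seq (seq nat)) : seq (seq nat) := t ++ nseq (N - size t) [::].

Lemma pad_cons N r t : pad N (r :: t) = r :: pad N.-1 t.
Proof. by rewrite /pad /= (_ : N - (size t).+1 = N.-1 - size t) //; lia. Qed.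

Lemma row_insert_pad N t x : row_insert (pad N t) x = pad N (row_insert t x).
Proof.
elim: t N x => [|r t IH] N x; first by case: N => //= N; rewrite /pad /= !subn1.
by rewrite pad_cons /=; case: ifP => _; rewrite pad_cons // IH.
Qed.

Lemma padded_rskE N w : padded_rsk N w = pad N (rsk_P w).
Proof.
elim/last_ind: w => [|w x IH]; first by rewrite /pad /= subn0.
by rewrite padded_rsk_rcons IH row_insert_pad /rsk_P foldl_rcons.
Qed.

(** As the parts of [l] are positive, equality of shapes leaves no room for a padding row. *)
Lemma padded_rsk_shape l w : all (fun x => 0 < x) l ->
  (map size (padded_rsk (size l) w) == l) = (rsk_shape w == l).
Proof.
move=> hl; rewrite padded_rskE /pad map_cat map_nseq -/(rsk_shape w) /= -(size_map size).
rewrite -/(rsk_shape w); apply/eqP/eqP => [e|->]; last by rewrite subnn cats0.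
move: hl; rewrite -[X in all _ X]e all_cat all_nseq /= orbF => /andP[_ /eqP h].
by move: e; rewrite h cats0.
Qed.

Lemma partition_decreasing l : is_partition l -> decreasing l.
Proof.
move=> /andP[hs _] i; case: (ltnP i.+1 (size l)) => hi; last by rewrite nth_default.
exact: (sortedP 0 hs).
Qed.

Lemma partition_size l : is_partition l -> size l <= sumn l.
Proof.
by move=> /andP[_]; elim: l => //= x l IH /andP[hx /IH]; lia.
Qed.

Lemma count_increasing_rsk n a l : partition_of n l -> a <= n ->
  count (fun w => increasing_above a w && (rsk_shape w == l)) (permutations (iota 1 n)) =
  f_shape l * f_skew l (n - a).
Proof.
move=> /andP[hp /eqP hn] ha; have hl := partition_decreasing _ hp.
have hsz := partition_size _ hp; have [_ hpos] := andP hp.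
rewrite /f_shape !f_skew_down //; last by lia.
rewrite (eq_count (a2 := fun w => increasing_above a w && (map size (padded_rsk (size l) w) == l))); last first.
  by move=> w /=; rewrite padded_rsk_shape.
rewrite count_increasing_shape // subn0 hn subKn //; congr muln.
(* The strip of size [n - a] is now removed after the [a] single boxes. It then has to be the whole
   remaining shape, which is the case of [hstrips_row]. *)
rewrite iter_down_hstrips //.
apply: (iter_down_ext decreasing (n - a)) => //; last by lia.
  by move=> s i; apply: decreasing_dec.
exact: hstrips_row.
Qed.

(** * Choice sequences, occupied boxes and Stirling numbers *)

Definition ffun_snoc (T : finType) (k : nat) (c : {ffun 'I_k -> T}) (x : T) : {ffun 'I_k.+1 -> T} :=
  [ffun i => oapp c x (unlift ord_max i)].

Lemma ffun_snoc_lift (T : finType) k (c : {ffun 'I_k -> T}) x i :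
  ffun_snoc _ _ c x (lift ord_max i) = c i.
Proof. by rewrite ffunE liftK. Qed.

Lemma ffun_snoc_max (T : finType) k (c : {ffun 'I_k -> T}) x :
  ffun_snoc _ _ c x ord_max = x.
Proof. by rewrite ffunE unlift_none. Qed.

Lemma sum_ffunS (T : finType) k (F : {ffun 'I_k.+1 -> T} -> nat) :
  \sum_c F c = \sum_(c : {ffun 'I_k -> T}) \sum_x F (ffun_snoc _ _ c x).
Proof.
rewrite pair_big /= (reindex (fun p => ffun_snoc T k p.1 p.2)) //=.
exists (fun c => ([ffun i => c (lift ord_max i)], c ord_max)) => [[c x]|c] _ /=.
  by rewrite ffun_snoc_max; congr pair; apply/ffunP => i; rewrite !ffunE liftK.
apply/ffunP => i; case: (unliftP ord_max i) => [j|] ->.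
  by rewrite ffun_snoc_lift ffunE.
by rewrite ffun_snoc_max.
Qed.

Lemma deck_after_snoc n k (c : {ffun 'I_k -> 'I_n}) x :
  deck_after (ffun_snoc _ _ c x) = top_to_random (deck_after c) x.
Proof.
rewrite /deck_after enum_ordSr map_rcons foldl_rcons ffun_snoc_max -map_comp.
congr (top_to_random (foldl _ _ _) _); apply: eq_map => i /=.
rewrite (_ : widen_ord _ i = lift ord_max i) ?ffun_snoc_lift //.
by apply: val_inj; exact: (esym (lift_max i)).
Qed.

Fixpoint stirling2 (k a : nat) : nat :=
  match k, a with
  | 0, 0 => 1
  | 0, _.+1 | _.+1, 0 => 0
  | k'.+1, a'.+1 => a'.+1 * stirling2 k' a'.+1 + stirling2 k' a'
  end.

(** The last ball falls into an occupied box or into a free one, which is the Stirling recurrence;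
    the number of free boxes supplies the next factor of the falling factorial. *)
Lemma card_ffun_imset_eq n k a :
  #|[set f : {ffun 'I_k -> 'I_n} | #|f @: 'I_k| == a]| = stirling2 k a * n ^_ a.
Proof.
rewrite cardsE -sum1_card big_mkcond /=.
elim: k a => [|k IH] a.
  rewrite (eq_bigr (fun=> (a == 0 : nat))) => [|f _].
    by rewrite sum_nat_const card_ffun !card_ord expn0 mul1n; case: a => [|a]; rewrite ?ffactn0.
  rewrite unfold_in (_ : f @: _ = set0) ?cards0; first by case: a.
  by apply/setP => x; rewrite inE; apply/imsetP => -[[]].
have him (c : {ffun 'I_k -> 'I_n}) x : ffun_snoc _ _ c x @: 'I_k.+1 = x |: (c @: 'I_k).
  apply/setP => y; rewrite !inE; apply/imsetP/orP => [[i _ ->]|[/eqP ->|/imsetP[i _ ->]]].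
  - case: (unliftP ord_max i) => [j|] ->; last by rewrite ffun_snoc_max eqxx; left.
    by rewrite ffun_snoc_lift; right; apply/imsetP; exists j.
  - by exists ord_max => //; rewrite ffun_snoc_max.
  - by exists (lift ord_max i) => //; rewrite ffun_snoc_lift.
rewrite sum_ffunS.
have hx (A : {set 'I_n}) b : \sum_x (if #|x |: A| == b then 1 else 0) =
    #|A| * (#|A| == b) + (n - #|A|) * (#|A|.+1 == b).
  rewrite (bigID (mem A)) /=; congr addn.
    rewrite (eq_bigr (fun=> (#|A| == b : nat))) ?sum_nat_const // => x hxA.
    by rewrite cardsU1 hxA; case: eqP.
  rewrite (eq_bigr (fun=> (#|A|.+1 == b : nat))) ?sum_nat_const.
    by congr muln; have := cardC A; rewrite card_ord => h; apply/eqP; rewrite -(eqn_add2l #|A|) subnKC -?[X in _ <= X]h ?leq_addr //; apply/eqP/h.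
  by move=> x hxA; rewrite cardsU1 hxA; case: eqP.
under eq_bigr => c _ do under eq_bigr => x _ do rewrite unfold_in him.
under eq_bigr => c _ do rewrite hx.
case: a => [|a].
  rewrite big1 // => c _; rewrite [_.+1 == 0]/= muln0 addn0.
  by case: eqP => [->|_]; rewrite ?muln0.
rewrite (eq_bigr (fun c : {ffun 'I_k -> 'I_n} =>
   a.+1 * (if #|c @: 'I_k| == a.+1 then 1 else 0) + (n - a) * (if #|c @: 'I_k| == a then 1 else 0))).
  rewrite big_split /= -!big_distrr /=.
  have := IH a.+1; have := IH a; rewrite /in_mem /= => -> ->.
  by rewrite ffactnSr; nia.
by move=> c _; rewrite eqSS; case: eqP => [->|]; case: eqP => [->|]; lia.
Qed.

(** Inverse of a shuffle with insertion position [i], so that sums can run over the deck after the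
    shuffle. *)
Definition move_to_front (v : seq nat) (i : nat) : seq nat :=
  nth 0 v i :: take i v ++ drop i.+1 v.

Lemma top_to_randomK w i : i < size w -> move_to_front (top_to_random w i) i = w.
Proof.
case: w => [|y w] //= hi.
have hs : size (take i w) = i by rewrite size_take; case: ltnP => //; lia.
rewrite /move_to_front nth_cat hs ltnn subnn /= take_size_cat //.
by rewrite -cat_rcons drop_size_cat ?size_rcons ?hs // cat_take_drop.
Qed.

Lemma perm_top_to_random w i : perm_eq (top_to_random w i) w.
Proof.
case: w => [|y w] //=; rewrite -[y :: w]/([:: y] ++ w) -[_ :: drop i w]/([:: y] ++ drop i w).
by rewrite perm_catCA cat_take_drop.
Qed.

Lemma perm_move_to_front v i : i < size v -> perm_eq (move_to_front v i) v.
Proof.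
move=> hi; rewrite perm_sym -{1}(cat_take_drop i v) (drop_nth 0 hi).
rewrite /move_to_front -[_ :: drop _ _]/([:: nth 0 v i] ++ _) -[X in perm_eq _ X]/([:: nth 0 v i] ++ _).
by rewrite perm_catCA.
Qed.

Lemma sum_top_to_random n (F : seq nat -> nat) i : i < n ->
  \sum_(w <- permutations (iota 1 n)) F (top_to_random w i) =
  \sum_(w <- permutations (iota 1 n)) F w.
Proof.
move=> hi; rewrite -(big_map (top_to_random^~ i) predT F); apply: perm_big.
have hsz w : w \in permutations (iota 1 n) -> i < size w.
  by rewrite mem_permutations => /perm_size ->; rewrite size_iota.
have hu : uniq [seq top_to_random w i | w <- permutations (iota 1 n)].
  rewrite map_inj_in_uniq ?permutations_uniq // => v w /hsz hv /hsz hw e.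
  by rewrite -(top_to_randomK v i) // e top_to_randomK.
have hsub : {subset [seq top_to_random w i | w <- permutations (iota 1 n)] <= permutations (iota 1 n)}.
  move=> x /mapP[w]; rewrite !mem_permutations => hw ->.
  exact: perm_trans (perm_top_to_random w i) hw.
apply: uniq_perm; rewrite ?permutations_uniq //.
by apply: (uniq_min_size hu hsub _).2; rewrite size_map.
Qed.

(** A card [y > a] brought to the front must be [a.+1], since otherwise [a.+1] stands behind it.
    When it is [a.+1], it is in order at the front and only the values above it matter. A card
    [y <= a] is invisible. *)
Lemma increasing_above_move_to_front n a v i : perm_eq v (iota 1 n) -> i < n ->
  let y := nth 0 v i in
  increasing_above a (move_to_front v i) =
  if y <= a then increasing_above a v
  else (y == a.+1) && increasing_above a.+1 v.
Proof.
move=> hp hi y; have hiv : i < size v by rewrite (perm_size hp) size_iota.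
have ev : v = take i v ++ y :: drop i.+1 v by rewrite -drop_nth // cat_take_drop.
have hu : uniq (move_to_front v i).
  by rewrite (perm_uniq (perm_move_to_front v i hiv)) (perm_uniq hp) iota_uniq.
rewrite /move_to_front -/y in hu *; set r := take i v ++ drop i.+1 v in hu *.
have hyr : y \notin r by case/andP: hu.
case: (leqP y a) => hya.
  by rewrite /increasing_above [in RHS]ev /= ltnNge hya /= !filter_cat /= ltnNge hya.
case: (y =P a.+1) => [ey|hne] /=.
  have -> : increasing_above a.+1 v = increasing_above a r.
    rewrite /increasing_above; have -> : [seq x <- v | a.+1 < x] = [seq x <- r | a.+1 < x].
      by rewrite [in LHS]ev filter_cat /= ey ltnn -filter_cat.
    congr sorted; apply: eq_in_filter => x hx; rewrite ltn_neqAle eq_sym.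
    by case: (x =P a.+1) => // ex; rewrite ey -ex hx in hyr.
  rewrite /increasing_above /= hya /= (path_sortedE ltn_trans) andb_idl // => _.
  apply/allP => x; rewrite mem_filter => /andP[hax hx]; rewrite ey ltn_neqAle hax andbT.
  by apply: contraNneq hyr => ex; rewrite ey ex.
have hyn : y \in iota 1 n by rewrite -(perm_mem hp) mem_nth.
have har : a.+1 \in r.
  have : a.+1 \in y :: r.
    rewrite (perm_mem (perm_move_to_front v i hiv)) (perm_mem hp).
    by move: hyn; rewrite !mem_iota; lia.
  by rewrite inE => /orP[/eqP e|//]; case: hne.
case/splitPr: har => r1 r2; rewrite -[y :: _]/([::] ++ y :: _).
by apply: increasing_aboveF => //; rewrite ltn_neqAle hya andbT eq_sym; apply/eqP.
Qed.

(** Summing over the card at position [i] instead of over [i]: the cards [1..a] give the first term,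
    and the newly touched card [a.+1], present if [a < n], gives the second. *)
Lemma sum_increasing_move_to_front n a v : a <= n -> perm_eq v (iota 1 n) ->
  \sum_(i < n) increasing_above a (move_to_front v i) =
  a * increasing_above a v + (a < n) * increasing_above a.+1 v.
Proof.
move=> han hp.
pose g y : nat := if y <= a then increasing_above a v else (y == a.+1) && increasing_above a.+1 v.
transitivity (\sum_(y <- v) g y).
  rewrite (big_nth 0) (perm_size hp) size_iota big_mkord; apply: eq_bigr => i _.
  by rewrite (increasing_above_move_to_front n) // /g; case: ifP.
rewrite (perm_big _ hp) /= -(subnKC han) iotaD big_cat /=; congr addn.
  rewrite (eq_big_seq (fun=> increasing_above a v : nat)) => [|y].
    by rewrite big_const_seq count_predT size_iota iter_addn_0 mulnC.
  by rewrite mem_iota /g => hy; rewrite (_ : y <= a) //; lia.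
rewrite subnKC // -subn_gt0 add1n; case: (n - a) => [|d] /=; first by rewrite big_nil.
rewrite big_cons big1_seq => [|y /=]; first by rewrite addn0 /g ltnn eqxx mul1n.
rewrite mem_iota /g => hy; rewrite ifF; last by lia.
by rewrite (_ : y == a.+1 = false) //; lia.
Qed.

Lemma sum_shuffle_step n a (phi : seq nat -> nat) : a <= n ->
  \sum_(w <- permutations (iota 1 n) | increasing_above a w) \sum_(x < n) phi (top_to_random w x) =
  a * (\sum_(w <- permutations (iota 1 n) | increasing_above a w) phi w) +
  (a < n) * (\sum_(w <- permutations (iota 1 n) | increasing_above a.+1 w) phi w).
Proof.
move=> han; set L := permutations (iota 1 n).
have hmk b (F : seq nat -> nat) : \sum_(w <- L | increasing_above b w) F w =
    \sum_(w <- L) increasing_above b w * F w.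
  by rewrite big_mkcond; apply: eq_bigr => w _; case: ifP; rewrite ?mul1n ?mul0n.
rewrite exchange_big /= !hmk.
transitivity (\sum_(x < n) \sum_(w <- L) increasing_above a (move_to_front w x) * phi w).
  apply: eq_bigr => x _.
  rewrite -(sum_top_to_random n (fun w => increasing_above a (move_to_front w x) * phi w) x) //.
  rewrite hmk; apply: eq_big_seq => w; rewrite mem_permutations => hw.
  by rewrite top_to_randomK // (perm_size hw) size_iota.
rewrite exchange_big /= !big_distrr /= -big_split /=.
apply: eq_big_seq => w; rewrite mem_permutations => hw.
by rewrite -big_distrl /= sum_increasing_move_to_front // mulnDl !mulnA.
Qed.

(* Conditionally on [a] cards having been touched, the deck is uniform among the
   arrangements in which the untouched cards are still in their original order. *)
Lemma sum_deck_after n k (phi : seq nat -> nat) :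
  \sum_(c : {ffun 'I_k -> 'I_n}) phi (deck_after c) =
  \sum_(0 <= a < n.+1)
    stirling2 k a * \sum_(w <- permutations (iota 1 n) | increasing_above a w) phi w.
Proof.
elim: k phi => [|k IH] phi.
  rewrite [LHS](eq_bigr (fun=> phi (iota 1 n))) => [|c _]; last first.
    by rewrite /deck_after enum_ord0.
  rewrite sum_nat_const card_ffun !card_ord expn0 mul1n.
  rewrite big_nat_recl // [X in _ + X]big1 // addn0.
  (* With no card touched every value must be in order, which leaves only the initial deck. *)
  have h1 : stirling2 0 0 * (\sum_(w <- permutations (iota 1 n) | increasing_above 0 w) phi w) =
      \sum_(w <- permutations (iota 1 n) | w == iota 1 n) phi w.
    rewrite mul1n big_seq_cond [RHS]big_seq_cond; apply: eq_bigl => w.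
    case hw: (w \in _) => //=; rewrite mem_permutations in hw.
    rewrite /increasing_above (_ : filter _ w = w); last first.
      by apply/all_filterP/allP => x; rewrite (perm_mem hw) mem_iota => /andP[].
    apply/idP/eqP => [hs|->]; last exact: iota_ltn_sorted.
    by apply: (irr_sorted_eq ltn_trans ltnn hs (iota_ltn_sorted _ _)); apply: perm_mem.
  rewrite h1 -big_filter (_ : filter _ _ = [:: iota 1 n]) ?big_seq1 //.
  by apply: filter_pred1_uniq; rewrite ?permutations_uniq ?mem_permutations.
rewrite sum_ffunS.
rewrite [LHS](eq_bigr (fun c => \sum_(x < n) phi (top_to_random (deck_after c) x))) => [|c _]; last first.
  by apply: eq_bigr => x _; rewrite deck_after_snoc.
rewrite (IH (fun d => \sum_(x < n) phi (top_to_random d x))).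
pose A a := \sum_(w <- permutations (iota 1 n) | increasing_above a w) phi w.
rewrite [LHS]big_nat [LHS](eq_bigr (fun a => stirling2 k a * (a * A a) + stirling2 k a * ((a < n) * A a.+1))); last first.
  by move=> a /andP[_ ha]; rewrite -mulnDr sum_shuffle_step.
(* The terms [a = 0] of the first sum and [a = n] of the second vanish; dropping them aligns the
   sums into the Stirling recurrence. *)
rewrite -big_nat big_split /= big_nat_recl // mul0n muln0 add0n.
rewrite [X in _ + X]big_nat_recr //= ltnn mul0n muln0 addn0 -big_split /=.
rewrite [RHS]big_nat_recl //= mul0n add0n !big_nat; apply: eq_bigr => a /andP[_ ha].
by rewrite ha mul1n mulnDl -/(A a.+1) mulnA [in LHS](mulnC (stirling2 k a.+1)).
Qed.

Import GRing.Theory Num.Theory.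
Local Open Scope ring_scope.

Theorem theorem7p5 (n k : nat) (l : seq nat) :
  (1 <= n)%N -> (1 <= k)%N -> partition_of n l ->
  prob_shape n k l =
    ((f_shape l)%:R ^+ 2 / (n`!)%:R) *
    \sum_(1 <= a < n.+1)
       P_occ a k n * ((n - a)`!)%:R * ((f_skew l (n - a))%:R / (f_shape l)%:R).
Proof.
move=> hn hk hl; case: k hk => // k _.
have card_shape : #|[set c : {ffun 'I_k.+1 -> 'I_n} | rsk_shape (deck_after c) == l]| =
    (\sum_(1 <= a < n.+1) stirling2 k.+1 a * (f_shape l * f_skew l (n - a)))%N.
  rewrite cardsE -sum1_card big_mkcond /=.
  rewrite (sum_deck_after n k.+1 (fun d => if rsk_shape d == l then 1 else 0))%N.
  (* The term [a = 0] vanishes because at least one shuffle was made. *)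
  rewrite big_nat_recl // mul0n add0n big_add1 !big_nat; apply: eq_bigr => a /andP[_ ha].
  rewrite -count_increasing_rsk // -sum1_count [in RHS]big_mkcond /= [in LHS]big_mkcond.
  by congr muln; apply: eq_bigr => w _; case: (increasing_above _ _).
have n0 : (n ^ k.+1)%:R != 0 :> rat by rewrite pnatr_eq0 expn_eq0; lia.
have f0 : n`!%:R != 0 :> rat by rewrite pnatr_eq0 -lt0n fact_gt0.
rewrite /prob_shape card_shape natr_sum mulr_suml mulr_sumr.
apply: eq_big_nat => a /andP[_ ha].
(* Writing [n!] as the falling factorial times [(n-a)!] lets both factors cancel. *)
rewrite /P_occ card_ffun_imset_eq -(ffact_fact (n := n) (m := a)) //.
rewrite -(ffact_fact (n := n) (m := a)) // natrM mulf_eq0 negb_or in f0.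
case/andP: f0 => f1 f2.
(* If [f_shape l] were 0, both sides would be 0; otherwise one factor of its square cancels the
   denominator. *)
case: (f_shape l =P 0)%N => [->|/eqP h]; first by rewrite mul0n muln0 mul0r expr0n /= !mul0r.
have h' : (f_shape l)%:R != 0 :> rat by rewrite pnatr_eq0.
by rewrite !natrM; field; rewrite n0 f1 f2 h'.
Qed.
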